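(* Let $\ell,\lambda$ be positive integers with $\lambda\ge 2$, and let $S=(a_1^*a_2^*\cdots a_\ell^*,\{a_1<a_2<\cdots<a_\ell\})$. Multiplication by $\lambda$ preserves $S$-recognizability (that is, for every $S$-recognizable set $X\subseteq\mathbb{N}$, the set $\lambda X=\{\lambda x: x\in X\}$ is also $S$-recognizable) if and only if one of the following holds: (i) $\ell=1$; (ii) $\ell=2$ and $\lambda$ is the square of an odd integer.
   Context: For $\ell\ge1$ let $\Sigma_\ell=\{a_1,\ldots,a_\ell\}$ be totally ordered by $a_1<\cdots<a_\ell$, and let $\mathcal{B}_\ell=a_1^*a_2^*\cdots a_\ell^*=\{a_1^{j_1}\cdots a_\ell^{j_\ell}: j_1,\ldots,j_\ell\ge0\}$. Words are ordered genealogically (radix/shortlex order): $x<y$ if $|x|<|y|$, or $|x|=|y|$ and $x$ is lexicographically smaller than $y$. An abstract numeration system is a triple $S=(L,\Sigma,<)$ with $L$ an infinite regular language over the totally ordered alphabet $(\Sigma,<)$; $\mathrm{rep}_S(n)$ denotes the $(n+1)$-st word of $L$ in genealogical order ($n\ge0$). A set $X\subseteq\mathbb{N}$ is $S$-recognizable if $\mathrm{rep}_S(X)$ is a regular language (accepted by a finite automaton). *)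

(* Defs.v *)
From HB Require Import structures.
From mathcomp Require Import all_boot all_order.
From mathcomp Require Import boolp classical_sets functions cardinality.

Set Implicit Arguments.
Unset Strict Implicit.
Unset Printing Implicit Defensive.

Local Open Scope classical_set_scope.

Record dfa (A : finType) := Dfa {
  dfa_state :> finType;
  dfa_init : dfa_state;
  dfa_final : {set dfa_state};
  dfa_step : dfa_state -> A -> dfa_state }.

Definition dfa_accept (A : finType) (M : dfa A) (w : seq A) : bool :=
  foldl (@dfa_step A M) (dfa_init M) w \in dfa_final M.

Definition regular (A : finType) (L : set (seq A)) : Prop :=
  exists M : dfa A, L = [set w | dfa_accept M w].

Section Numeration.
Context {d : Order.disp_t} {A : finOrderType d}.
Implicit Types (L : set (seq A)) (X : set nat) (v w : seq A).

Definition gen_lt v w : bool :=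
  (size v < size w) ||
  ((size v == size w) && (v < w :> seqlexi A)%O).

(* The word w is the (n+1)-st word of L in genealogical order iff exactly n words of L
   precede it, which determines w.
   The default value [::] is only taken when L has at most n words. *)
Definition rep L (n : nat) : seq A :=
  xget [::] [set w | L w /\ ([set v | L v /\ gen_lt v w] #= `I_n)%card].

Definition recognizable L X : Prop := regular (rep L @` X).

Definition mul_preserves_recognizable L (lambda : nat) : Prop :=
  forall X, recognizable L X -> recognizable L [set lambda * x | x in X].

End Numeration.

(* The letter a_i is the ordinal i - 1 of 'I_l, with its usual order. *)
Definition bounded_lang (l : nat) : set (seq 'I_l) :=
  [set w | exists j : 'I_l -> nat,
     w = flatten [seq nseq (j i) i | i <- enum 'I_l]].
Arguments bounded_lang l : clear implicits.

(* Main.v *)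
Require Import Defs.
From HB Require Import structures.
From mathcomp Require Import all_boot all_order all_algebra.
From mathcomp Require Import polyrcf realalg.
From mathcomp Require Import boolp classical_sets functions cardinality.
From mathcomp Require Import zify ring lra.

(* A word of the language is given by its vector [c] of exponents.  Its rank is
   the sum over [i] of the number of multisets of size [l - i] on
   [c i + c (i + 1) + ...] elements, and a set of words is regular iff the
   corresponding set of vectors is invariant, away from the axes, under a common
   period in every coordinate.  The theorem is thus about the relation
   [value c = lambda * value c'].

   For [l = 2] and [lambda = b ^ 2] with [b] odd, [c'] is, on finitely many
   cones, an affine function of [c], and raising a coordinate of [c] by [b ^ 2 * T]
   raises the coordinates of [c'] by multiples of [T].  Conversely, pumping in the image
   of [a_1^*] shows that [lambda * (2 n_k + 1) ^ 2 = (2 k T + u) ^ 2 + C] is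
   solvable for all [k], with [u] odd; two large squares at bounded distance being
   equal, [C = 0] and [lambda] is an odd square.

   For [l >= 3] put [D = l - 1] and replace [lambda] by its power [b ^ l] with
   [b = lambda ^ D].  In the image of [a_1^* a_2^*] choose a word whose length is
   [b * n + i], where [n] is the length of its preimage and [i] exceeds the mean
   offset [(b - 1) * D / 2] by [h / 2], where [h] is [3] or [4].  When its letters
   [a_1] are pumped, the length of the preimage must be [n + k * T], and the number
   [z_k] of letters [a_2] in the preimage grows like [rho * k] with
   [rho ^ D = h * T ^ D / (2 * b)].  As the integers [z_k] solve a polynomial
   equation in [k], their differences converge, so [rho] is an integer.  But [b] is
   a [D]-th power and [h / 2] has 2-adic valuation [1] or [-1]. *)

Import Order.TTheory GRing.Theory Num.Theory.

Set Implicit Arguments.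
Unset Strict Implicit.
Unset Printing Implicit Defensive.

Local Open Scope classical_set_scope.

(** * Ranks of words *)

(** For [m > 0] this is also the number of words of length less than [x] in [bounded_lang m]. *)
Definition multichoose m x := 'C(x + m.-1, m).

Lemma multichoose0 m : 0 < m -> multichoose m 0 = 0.
Proof. by case: m => // m _; rewrite /multichoose add0n bin_small. Qed.

Lemma multichooseS m x :
  multichoose m.+1 x.+1 = multichoose m.+1 x + multichoose m x.+1.
Proof.
rewrite /multichoose /= addSn binS; congr (_ + _).
by case: m => [|m]; rewrite ?bin0 //= addSnnS.
Qed.

Lemma leq_multichoose m x y : x <= y -> multichoose m x <= multichoose m y.
Proof. by move=> xy; rewrite /multichoose leq_bin2l // leq_add2r. Qed.

Lemma ltn_multichoose m x y : multichoose m x < multichoose m y -> x < y.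
Proof. by apply: contraTT; rewrite -!leqNgt; apply: leq_multichoose. Qed.

Lemma leq_multichoose_id m x : 0 < m -> x <= multichoose m x.
Proof.
case: m => // m _; elim: x => // x IH.
by rewrite multichooseS -addn1 leq_add // /multichoose bin_gt0; lia.
Qed.

Lemma mul_multichoose m x :
  m.+1 * multichoose m.+1 x = (x + m) * multichoose m x.
Proof.
rewrite /multichoose /=; case: m => [|m]; first by rewrite !addn0 bin1 bin0; lia.
by rewrite addnS -mul_bin_diag.
Qed.

Lemma fact_multichoose m x : m`! * multichoose m x = \prod_(j < m) (x + j).
Proof.
elim: m => [|m IH]; first by rewrite big_ord0 /multichoose bin0.
by rewrite big_ord_recr /= -IH factS mulnAC mul_multichoose -mulnA [_ * m`!]mulnC mulnC.
Qed.

(** Pascal's rule [multichooseS] is iterated: each step spends one term and leaves room for the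
    rest, because the [x i] do not increase. *)
Lemma sum_multichoose_lt (x : nat -> nat) l s : s <= l ->
  (forall i, x i.+1 <= x i) ->
  \sum_(s <= i < l) multichoose (l - i) (x i) < multichoose (l - s) (x s).+1.
Proof.
move=> sl xdec; move def_m: (l - s) => m.
elim: m s sl def_m => [|m IH] s sl def_m.
  by rewrite big_geq /multichoose ?bin0 //; lia.
rewrite big_ltn ?def_m; last lia.
rewrite multichooseS ltn_add2l.
apply: leq_trans (IH s.+1 _ _) _; [lia | lia |].
by apply: leq_multichoose; rewrite ltnS.
Qed.

(** Greedy expansion in the combinatorial number system: [x 0] is the largest argument whose term
    fits into [n], and by Pascal's rule the remainder forces the next argument to be at most
    [x 0]. *)
Lemma multichoose_decomposition m n X : n < multichoose m X.+1 ->
  exists x : nat -> nat, [/\ forall i, x i.+1 <= x i, x 0 <= X, x m = 0 &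
    \sum_(i < m) multichoose (m - i) (x i) = n].
Proof.
elim: m n X => [|m IH] n X.
  rewrite /multichoose bin0 => n1; exists (fun=> 0); split=> //.
  by rewrite big_ord0; lia.
move=> nX.
have h0 : exists i, multichoose m.+1 i <= n by exists 0; rewrite multichoose0.
have hb i : multichoose m.+1 i <= n -> i <= X.
  by move=> /leq_ltn_trans /(_ nX) /ltn_multichoose.
case: (ex_maxnP h0 hb) => x0 x0n x0max.
have : n < multichoose m.+1 x0.+1.
  by rewrite ltnNge; apply/negP => /x0max; rewrite ltnn.
rewrite multichooseS => nS.
have /IH[x [xdec xx0 xm sx]] : n - multichoose m.+1 x0 < multichoose m x0.+1.
  lia.
exists (fun i => if i is i'.+1 then x i' else x0); split=> //.
- by case.
- exact: hb.
by rewrite big_ord_recl /= subn0 sx; lia.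
Qed.

(** * Words as exponent vectors, and their ranks *)

Section Words.
Variable l : nat.
Implicit Types (c : 'I_l -> nat) (v w : seq 'I_l).

Definition word c := flatten [seq nseq (c i) i | i <- enum 'I_l].

Definition tail c i := \sum_(j < l | i <= j) c j.

Definition value c := \sum_(i < l) multichoose (l - i) (tail c i).

Local Notation wsorted := (pairwise (fun a b : 'I_l => a <= b)).
Let wcount w i := count (fun a : 'I_l => i <= a) w.
Let wvalue w := \sum_(0 <= i < l) multichoose (l - i) (wcount w i).

Lemma count_word P c : count P (word c) = \sum_(i < l | P i) c i.
Proof.
rewrite /word count_flatten -map_comp sumnE big_map big_enum /=.
rewrite [RHS]big_mkcond; apply: eq_bigr => i _.
by rewrite /= count_nseq; case: (P i); rewrite ?mul1n ?mul0n.
Qed.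

Lemma count_mem_word c i : count_mem i (word c) = c i.
Proof. by rewrite count_word big_pred1_eq. Qed.

Lemma word_inj : injective word.
Proof. by move=> c c' e; apply/funext => i; rewrite -count_mem_word e count_mem_word. Qed.

Lemma word_sorted c : wsorted (word c).
Proof.
rewrite /word.
have : pairwise (fun i j : 'I_l => i <= j) (enum 'I_l).
  rewrite -(pairwise_map (@nat_of_ord l)) val_enum_ord.
  by rewrite -(sorted_pairwise leq_trans) iota_sorted.
elim: (enum 'I_l) => //= i s IH /andP[his /IH hs].
rewrite pairwise_cat hs andbT; apply/andP; split.
  apply/allrelP => x y; rewrite mem_nseq => /andP[_ /eqP->] /flattenP[t].
  move=> /mapP[j js ->]; rewrite mem_nseq => /andP[_ /eqP->].
  exact: (allP his).
by elim: (c i) => //= p ->; rewrite andbT; apply/allP => x; rewrite mem_nseq => /andP[_ /eqP->].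
Qed.

Lemma word_count w : wsorted w -> word (fun i => count_mem i w) = w.
Proof.
move=> sw; have le_trans : transitive (fun a b : 'I_l => a <= b).
  by move=> a b c; apply: leq_trans.
apply: (@sorted_eq _ (fun a b : 'I_l => a <= b)) => //.
- by move=> a b; rewrite -eqn_leq => /eqP/ord_inj.
- by rewrite (sorted_pairwise le_trans) word_sorted.
- by rewrite (sorted_pairwise le_trans).
by apply/allP => i _; rewrite /= count_mem_word.
Qed.

Lemma value_word c : value c = wvalue (word c).
Proof.
rewrite /value /wvalue big_mkord; apply: eq_bigr => i _.
by rewrite /wcount count_word.
Qed.

Let wcountS w i : wcount w i.+1 <= wcount w i.
Proof. by apply: sub_count => a /=; apply: ltnW. Qed.

Let wcount0 w : wcount w 0 = size w.
Proof. exact: count_predT. Qed.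

Let wcount_path a w i : all (fun b : 'I_l => a <= b) w -> i <= a ->
  wcount w i = size w.
Proof.
move=> aw ia; apply/eqP; rewrite -all_count.
by apply: sub_all aw => b /=; apply: leq_trans.
Qed.

(** A common first letter adds the same amount to both values, the sizes being equal. If the first
    letters are [a < b], the terms up to index [a] agree; at [a.+1] the larger word still counts all
    its letters and the smaller one misses its first, which outweighs all later terms. *)
Let wvalue_lt_lexi v w : wsorted v -> wsorted w -> size v = size w ->
  (v < w :> seqlexi 'I_l)%O -> wvalue v < wvalue w.
Proof.
elim: v w => [|a v IH] [|b w] //=; move=> /andP[av sv] /andP[bw sw] [svw]; rewrite ltxi_cons => /andP[ab].
have {}ab : a <= b by [].
have [ba|ba _] := leqP b a.
  have eab : b = a by apply/ord_inj; lia.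
  subst b; rewrite lexx /= => /(IH _ sv sw svw).
  suff : wvalue (a :: v) + wvalue w = wvalue (a :: w) + wvalue v by lia.
  rewrite /wvalue -!big_split /=; apply: eq_big_nat => i /andP[_ il].
  rewrite /wcount /= -!/(wcount _ _).
  case: (leqP i a) => ia; last by rewrite !add0n addnC.
  by rewrite !(wcount_path _ ia) // svw.
have al := ltn_ord a; have bl := ltn_ord b.
have split u : wvalue u = \sum_(0 <= i < a.+1) multichoose (l - i) (wcount u i) +
    \sum_(a.+1 <= i < l) multichoose (l - i) (wcount u i).
  by rewrite /wvalue (big_cat_nat (n := a.+1)).
rewrite !split.
set S := \sum_(0 <= i < a.+1) _; set S' := \sum_(0 <= i < a.+1) _.
have -> : S' = S.
  apply: eq_big_nat => i /andP[_ ia]; rewrite (@wcount_path a (a :: v)) ?(@wcount_path b (b :: w)) /= ?leqnn ?bw ?svw //.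
  by apply: leq_trans ab; rewrite -ltnS.
rewrite ltn_add2l.
have := @sum_multichoose_lt (wcount (a :: v)) l a.+1 al (wcountS _).
move=> /leq_trans; apply.
apply: (@leq_trans (multichoose (l - a.+1) (wcount (b :: w) a.+1))).
  apply: leq_multichoose; rewrite (@wcount_path b (b :: w)) /= ?leqnn ?bw //.
  by rewrite /wcount /= ltnn add0n -svw ltnS count_size.
by rewrite big_ltn ?leq_addr //; lia.
Qed.

Lemma value_lt c c' : 0 < l -> gen_lt (word c) (word c') -> value c < value c'.
Proof.
move=> l0; rewrite !value_word => /orP[lt_size|/andP[/eqP eq_size]]; last first.
  by apply: wvalue_lt_lexi; rewrite ?word_sorted.
apply: leq_trans (sum_multichoose_lt (leq0n l) (wcountS (word c))) _.
rewrite wcount0 /wvalue big_ltn // wcount0 (leq_trans _ (leq_addr _ _)) //.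
exact: leq_multichoose.
Qed.

Lemma gen_lt_total v w : [\/ gen_lt v w, v = w | gen_lt w v].
Proof.
rewrite /gen_lt; case: (ltngtP (size v) (size w)) => //= _; try by constructor.
by case: (ltgtP (v : seqlexi 'I_l) (w : seqlexi 'I_l)); constructor.
Qed.

Lemma value_ltE c c' : 0 < l -> gen_lt (word c) (word c') = (value c < value c').
Proof.
move=> l0; apply/idP/idP; first exact: value_lt.
case: (gen_lt_total (word c) (word c')) => // [/word_inj->|/(value_lt l0)].
  by rewrite ltnn.
by move=> h1 /(ltn_trans h1); rewrite ltnn.
Qed.

Lemma value_inj : 0 < l -> injective value.
Proof.
move=> l0 c c' e; apply: word_inj.
by case: (gen_lt_total (word c) (word c')) => //; rewrite value_ltE // e ltnn.
Qed.

Lemma tail_diff (x : nat -> nat) i : (forall i, x i.+1 <= x i) -> x l = 0 ->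
  i <= l -> tail (fun j => x j - x j.+1) i = x i.
Proof.
move=> xdec xl il; rewrite /tail.
rewrite -(big_mkord (fun j => i <= j) (fun j => x j - x j.+1)).
rewrite (big_cat_nat (n := i)) //= big_hasC; last first.
  by apply/hasPn => j; rewrite mem_index_iota; lia.
rewrite add0n big_nat_cond (eq_bigl (fun j => i <= j < l)); last by move=> j; lia.
rewrite -big_nat.
suff h k : i <= k -> \sum_(i <= j < k) (x j - x j.+1) + x k = x i.
  by rewrite -(h l il) xl addn0.
elim: k => [|k IH] ik; first by rewrite big_geq //; congr x; lia.
have [->|{}ik] : i = k.+1 \/ i <= k by lia.
  by rewrite big_geq.
by rewrite big_nat_recr //= -addnA subnK // IH.
Qed.

Lemma value_surj n : 0 < l -> exists c, value c = n.
Proof.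
move=> l0; have nl : n < multichoose l n.+1 by exact: leq_multichoose_id.
have [x [xdec _ xl <-]] := multichoose_decomposition nl.
exists (fun j => x j - x j.+1); apply: eq_bigr => i _.
by rewrite tail_diff // ltnW.
Qed.

(** As [value] is an increasing bijection onto the naturals, the words before [word c] correspond to
    the integers below [value c]. *)
Lemma rep_value c : 0 < l -> rep (bounded_lang l) (value c) = word c.
Proof.
move=> l0.
have card c' : ([set v | bounded_lang l v /\ gen_lt v (word c')] #= `I_(value c'))%card.
  have [inv invK] := choice (fun n => value_surj n l0).
  have -> : [set v | bounded_lang l v /\ gen_lt v (word c')]%classic =
            ((word \o inv) @` `I_(value c'))%classic.
    apply/seteqP; split=> v /=.
      move=> [[c'' ->]]; rewrite -/(word c'') value_ltE // => lt_c.
      by exists (value c'') => //; congr word; apply: value_inj.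
    move=> [k kc <-]; split; first by exists (inv k).
    by rewrite value_ltE // invK.
  apply: inj_card_eq => i j _ _ /word_inj e.
  by rewrite -[i]invK e invK.
apply: xget_unique; first by split; [exists c | exact: card].
move=> _ [[c' ->] card']; rewrite -/(word c') in card' *.
congr word; apply: value_inj => //.
by apply/card_eq_II; apply: (card_eq_trans _ card'); rewrite card_eq_sym card.
Qed.

(** * Regular languages and periodic sets of exponent vectors *)

Definition raise c a t : 'I_l -> nat := fun i => c i + (i == a) * t.

(* Equivalently, [Z] is a finite union of products of ultimately periodic sets. *)
Definition rec_set (Z : set ('I_l -> nat)) :=
  exists N T, 0 < T /\ forall c a, N <= c a -> (Z c <-> Z (raise c a T)).

(** The orbit closes up with a period at most [#|S|], which divides the factorial. The factorial
    thus serves all letters and all states at once. *)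
Lemma iter_fact (S : finType) (f : S -> S) p x : #|S| <= p ->
  iter (p + #|S| `!) f x = iter p f x.
Proof.
move=> Sp; set o := order f x.
have o0 : 0 < o by apply: order_gt0.
have oS : o <= #|S| by apply: max_card.
have /trajectP[j jo ej] : looping f x o by apply: looping_order.
clearbody o.
have per q k : j <= q -> iter (q + k * (o - j)) f x = iter q f x.
  move=> jq; elim: k => [|k IH]; first by rewrite addn0.
  have -> : q + k.+1 * (o - j) = (q + k * (o - j) - j) + o.
    by rewrite mulSn; move: (k * (o - j)); lia.
  rewrite iterD ej -iterD -[RHS]IH; congr iter; lia.
have /dvdnP[k ->] : o - j %| #|S| `! by apply: dvdn_fact; lia.
by apply: per; lia.
Qed.

Lemma word_raise c a : exists u v,
  forall t, word (raise c a t) = u ++ nseq (c a + t) a ++ v.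
Proof.
have := enum_uniq 'I_l; rewrite /word.
case/splitPr: (mem_enum 'I_l a) => s1 s2.
rewrite cat_uniq /= negb_or => /and4P[_ /andP[as1 _] as2 _].
exists (flatten [seq nseq (c i) i | i <- s1]), (flatten [seq nseq (c i) i | i <- s2]) => t.
have raiseE s : a \notin s ->
    [seq nseq (raise c a t i) i | i <- s] = [seq nseq (c i) i | i <- s].
  move=> as'; apply/eq_in_map => i is'; rewrite /raise.
  by case: eqP => [ia|_]; [rewrite ia (negPf as') in is' | rewrite mul0n addn0].
by rewrite map_cat flatten_cat /= !raiseE // /raise eqxx mul1n.
Qed.

Lemma rec_set_multiple Z N T k : 
  (forall c a, N <= c a -> (Z c <-> Z (raise c a T))) ->
  forall c a, N <= c a -> (Z c <-> Z (raise c a (k * T))).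
Proof.
move=> per c a ca; elim: k => [|k IH].
  suff -> : raise c a (0 * T) = c by [].
  by apply/funext => i; rewrite /raise muln0 addn0.
rewrite IH (per _ a); last by rewrite /raise (leq_trans ca) // leq_addr.
suff -> : raise (raise c a (k * T)) a T = raise c a (k.+1 * T) by [].
by apply/funext => i; rewrite /raise -addnA -mulnDr mulSn [T + _]addnC.
Qed.

(** An automaton reads a run of one letter by iterating one map of its states, whence a period.
    Conversely, an automaton can keep each exponent up to threshold and period, and check in one bit
    that the letters do not decrease. *)
Lemma regular_wordP (Z : set ('I_l -> nat)) : regular (word @` Z) <-> rec_set Z.
Proof.
have ZE c : Z c <-> (word @` Z)%classic (word c).
  by split=> [|[c' Zc' /word_inj <-]] //; exists c.
split=> [[M defM]|[N0 [T [T0 per0]]]].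
  exists #|M|, #|M| `!; split; first exact: fact_gt0.
  move=> c a ca; rewrite (ZE c) (ZE (raise _ _ _)) defM /=.
  have [u [v uv]] := word_raise c a.
  have := uv 0; have -> : raise c a 0 = c.
    by apply/funext => i; rewrite /raise muln0 addn0.
  rewrite addn0 => ->; rewrite uv /dfa_accept !foldl_cat.
  have foldE s p : foldl (@dfa_step _ M) s (nseq p a) = iter p (@dfa_step _ M ^~ a) s.
    by elim: p s => // p IH s; rewrite iterSr -IH.
  by rewrite !foldE iter_fact.
(* A positive threshold ensures that a folded counter is [0] only if its letter has not occurred, as
   the test in [step] requires. *)
pose N := N0.+1.
have per c a : N <= c a -> (Z c <-> Z (raise c a T)).
  by move=> ca; apply: per0; apply: ltnW.
pose r p := if p < N then p else N + (p - N) %% T.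
have r_lt p : r p < N + T.
  by have := ltn_pmod (p - N) T0; rewrite /r; case: ifP; lia.
have rS p : r (r p).+1 = r p.+1.
  have [pN|pN] := ltnP p N; first by rewrite {2}/r pN.
  rewrite {2}/r ltnNge pN /= /r ltnNge leqW ?leq_addr //= ltnNge leqW //=.
  have -> : (N + (p - N) %% T).+1 - N = (p - N) %% T + 1 by lia.
  by rewrite modnDml; congr (_ + _ %% _); lia.
have r_mod p : N <= p -> exists k, p = r p + k * T.
  move=> pN; exists ((p - N) %/ T); rewrite /r ltnNge pN /=.
  by have := divn_eq (p - N) T; lia.
have Zr c : Z c <-> Z (r \o c).
  (* Coordinates are folded one at a time, since periodicity concerns a single coordinate. *)
  pose cr (s : seq 'I_l) i := if i \in s then r (c i) else c i.
  suff h s : Z c <-> Z (cr s).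
    by rewrite (h (enum 'I_l)); suff -> : cr (enum 'I_l) = r \o c by []; apply/funext => i; rewrite /cr mem_enum.
  elim: s => [|a s ->]; first by suff -> : cr [::] = c by [].
  have [as_|as_] := boolP (a \in s).
    suff -> : cr (a :: s) = cr s by [].
    by apply/funext => i; rewrite /cr inE; case: eqP => // ->; rewrite as_.
  have [ca|ca] := ltnP (c a) N.
    suff -> : cr (a :: s) = cr s by [].
    apply/funext => i; rewrite /cr inE; case: eqP => // ->.
    by rewrite (negPf as_) /r ca.
  have [k ek] := r_mod _ ca.
  rewrite [Z (cr (a :: s))](rec_set_multiple k per (a := a)); last first.
    by rewrite /cr inE eqxx /r ltnNge ca leq_addr.
  suff -> : raise (cr (a :: s)) a (k * T) = cr s by [].
  apply/funext => i; rewrite /raise /cr inE; case: eqP => [->|_] /=.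
    by rewrite (negPf as_) mul1n -ek.
  by rewrite addn0.
pose S : finType := ({ffun 'I_l -> 'I_(N + T)} * bool)%type.
pose step (s : S) a : S := ([ffun i => if i == a then Ordinal (r_lt (s.1 i).+1) else s.1 i],
  s.2 && [forall i : 'I_l, (a < i) ==> (s.1 i == 0 :> nat)]).
pose state w : S := ([ffun i => Ordinal (r_lt (count_mem i w))], wsorted w).
pose final := [set s : S | s.2 && `[< Z (fun i => s.1 i) >]]%SET.
have stateP w : foldl step (state [::]) w = state w.
  elim/last_ind: w => // w a IH; rewrite foldl_rcons IH /step /=; congr pair.
    apply/ffunP => i; rewrite !ffunE; apply/val_inj; rewrite /= -cats1 count_cat /=.
    by rewrite [a == i]eq_sym; case: eqP => _ /=; rewrite ?rS ?addn0 ?addn1.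
  rewrite pairwise_rcons andbC; congr (_ && _).
  apply/forallP/allP => [h b bw|h i].
    rewrite leqNgt; apply/negP => ab; have := h b; rewrite ab ffunE /= /r.
    case: ltnP => // _ /eqP; have : 0 < count_mem b w by rewrite -has_count has_pred1.
    by case: (count_mem b w).
  apply/implyP => ai; rewrite ffunE /=; suff -> : count_mem i w = 0 by [].
  by apply/count_memPn/negP => /h /=; rewrite leqNgt ai.
exists (Dfa (state [::]) final step); apply/seteqP; split=> w /=.
  move=> [c Zc <-]; rewrite /dfa_accept /= stateP inE /= word_sorted /=.
  apply/asboolP; move/Zr: Zc; congr Z; apply/funext => i /=.
  by rewrite ffunE /= count_mem_word.
rewrite /dfa_accept /= stateP inE /= => /andP[sw /asboolP Zw].
exists (fun i => count_mem i w); last exact: word_count.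
by apply/Zr; move: Zw; congr Z; apply/funext => i /=; rewrite ffunE.
Qed.

(** * Multiplication as a relation between exponent vectors *)

Lemma mul_preservesP lambda : 0 < l ->
  mul_preserves_recognizable (bounded_lang l) lambda <->
  forall Z, rec_set Z ->
    rec_set [set c | exists2 c', Z c' & value c = lambda * value c'].
Proof.
move=> l0; have repE X : rep (bounded_lang l) @` X = word @` [set c | X (value c)].
  apply/seteqP; split=> [w /= [n Xn <-]|w /= [c Xc <-]].
    by have [c cn] := value_surj n l0; exists c; rewrite /= -?cn ?rep_value // cn.
  by exists (value c); rewrite ?rep_value.
have recE X : recognizable (bounded_lang l) X <-> rec_set [set c | X (value c)].
  by rewrite /recognizable repE; exact: regular_wordP.
have imE Z : [set c | exists2 c', Z c' & value c = lambda * value c'] =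
   [set c | [set lambda * x | x in [set value c' | c' in Z]] (value c)].
  apply/seteqP; split=> c /=; first by move=> [c' Zc' ->]; exists (value c') => //; exists c'.
  by move=> [_ [c' Zc' <-] <-]; exists c'.
have valE Z : [set c | [set value c' | c' in Z] (value c)] = Z.
  apply/seteqP; split=> c /=; last by exists c.
  by move=> [c' Zc' /(value_inj l0) <-].
split=> [pres Z recZ|pres X /recE recX]; last first.
  apply/recE; move: (pres _ recX); rewrite imE.
  suff -> : [set value c' | c' in [set c | X (value c)]] = X by [].
  apply/seteqP; split=> n /=; first by move=> [c Xc <-].
  by move=> Xn; have [c cn] := value_surj n l0; exists c; rewrite /= cn.
by rewrite imE; apply/recE; apply: pres; apply/recE; rewrite valE.
Qed.

Lemma mul_preserves_exp lambda k : 0 < k ->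
  mul_preserves_recognizable (bounded_lang l) lambda ->
  mul_preserves_recognizable (bounded_lang l) (lambda ^ k).
Proof.
case: k => // k _ pres; elim: k => [|k IH] X recX; first by apply: pres.
have := pres _ (IH _ recX).
suff -> : [set lambda ^ k.+2 * x | x in X] =
  [set lambda * x | x in [set lambda ^ k.+1 * x | x in X]] by [].
apply/seteqP; split=> n /=.
  by move=> [x Xx <-]; exists (lambda ^ k.+1 * x); [exists x | rewrite mulnA -expnS].
by move=> [_ [x Xx <-] <-]; exists x => //; rewrite mulnA -expnS.
Qed.

End Words.

(** * The square of an odd integer, two letters *)

Section OddSquare.
Local Open Scope ring_scope.
Variables b g : int.
Hypotheses (g0 : 0 <= g) (bE : b = 2 * g + 1).

(* The two sides are twice the values of [a_1^p' a_2^q'] and [a_1^p a_2^q],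
   the latter multiplied by [b ^ 2]. *)
Definition scaled (p q p' q' : int) :=
  (p' + q') * (p' + q' + 1) + 2 * q' = b ^+ 2 * ((p + q) * (p + q + 1) + 2 * q).

(** Completing squares in [scaled] puts [p' + q'] near [b * (p + q) + g], where [g] is half of
    [b - 1]. For large [p'] or [q'] the deviation takes finitely many values, and these index the
    cones. *)
Definition defect (p q p' q' : int) : int := p' + q' - b * (p + q) - g.

Let scaled_q p q p' q' (j : int) : scaled p q p' q' -> j = defect p q p' q' ->
  2 * b ^+ 2 * q = 2 * j * p' + 2 * (j + 1) * q' + g * (g + 1) - j * (j - 1).
Proof. by rewrite /scaled /defect bE => e ->; lra. Qed.

Let scaled_p p q p' q' (j : int) : scaled p q p' q' -> j = defect p q p' q' ->
  2 * b ^+ 2 * p = 2 * (b - j) * p' + 2 * (b - j - 1) * q' +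
    j * (j - 1) - 2 * b * j - 2 * b * g - g * (g + 1).
Proof. by rewrite /scaled /defect bE => e ->; lra. Qed.

(** The increments of [p] and [q] are [b ^ 2 * t] times their slopes in [p']; they leave the defect
    unchanged. *)
Lemma scaled_raise_l p q p' q' t (j : int) : j = defect p q p' q' ->
  scaled (p + (b - j) * t) (q + j * t) (p' + b ^+ 2 * t) q' <-> scaled p q p' q'.
Proof.
rewrite /scaled /defect bE => ->.
by split=> e; lra.
Qed.

Lemma scaled_raise_r p q p' q' t (j : int) : j = defect p q p' q' ->
  scaled (p + (b - j - 1) * t) (q + (j + 1) * t) p' (q' + b ^+ 2 * t) <->
  scaled p q p' q'.
Proof.
rewrite /scaled /defect bE => ->.
by split=> e; lra.
Qed.

Let b0 : 0 < b. Proof. by rewrite bE; lia. Qed.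

Let mul_pred_ge0 (j : int) : 0 <= j * (j - 1).
Proof. by have [j0|j0] := lerP j 0; [rewrite mulr_le0 // | rewrite mulr_ge0 //]; lia. Qed.

(** By [scaled_p], a defect [j >= b] would make [p] negative; the positive term [j * (j - 1)] is
    outweighed because [p' + q' >= g + j]. *)
Lemma defect_lt p q p' q' : scaled p q p' q' ->
  0 <= p -> 0 <= q -> 0 <= p' -> 0 <= q' -> defect p q p' q' < b.
Proof.
move=> e p0 q0 p'0 q'0; rewrite ltNge; apply/negP => jb.
have [j ej] : exists j : int, j = defect p q p' q' by exists (defect p q p' q').
have ep := scaled_p e ej; rewrite -ej in jb; rewrite /defect in ej.
have h0 : 0 <= 2 * b ^+ 2 * p by rewrite mulr_ge0 // mulr_ge0 // sqr_ge0.
have h1 : 0 <= (j - b) * (b * (p + q)).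
  by apply: mulr_ge0; [rewrite subr_ge0 | apply: mulr_ge0; [exact: ltW | exact: addr_ge0]].
have {h1}h1 : 0 <= (j - b) * (p' + q' - g - j).
  by suff -> : p' + q' - g - j = b * (p + q) by []; lia.
have j0 : 0 < j by exact: lt_le_trans b0 jb.
have h2 : 0 <= j * g by rewrite mulr_ge0 // ltW.
have h3 : 0 < j * j by rewrite mulr_gt0.
lia.
Qed.

(** In [scaled_q] the coefficient [2 * j] of [p'] is negative for [j < 0], and a large [p'] then
    forces [q < 0]. *)
Lemma defect_ge0 p q p' q' : scaled p q p' q' ->
  0 <= p -> 0 <= q -> 0 <= q' -> g * (g + 1) < p' -> 0 <= defect p q p' q'.
Proof.
move=> e p0 q0 q'0 p'g; rewrite leNgt; apply/negP => j0.
have := scaled_q e erefl; move: (defect _ _ _ _) j0 => j j0.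
have h0 : 0 <= 2 * b ^+ 2 * q by rewrite mulr_ge0 // mulr_ge0 // sqr_ge0.
have h1 : 0 <= (- 1 - j) * p' by rewrite mulr_ge0; lia.
have h2 : 0 <= (- 1 - j) * q' by rewrite mulr_ge0; lia.
have h3 := mul_pred_ge0 j.
lia.
Qed.

(** The bound is [-1] because in [scaled_q] the coefficient of [q'] is [2 * (j + 1)], which vanishes
    at [j = -1]. *)
Lemma defect_geN1 p q p' q' : scaled p q p' q' ->
  0 <= p -> 0 <= q -> 0 <= p' -> g * (g + 1) < q' -> -1 <= defect p q p' q'.
Proof.
move=> e p0 q0 p'0 q'g; rewrite leNgt; apply/negP => j0.
have := scaled_q e erefl; move: (defect _ _ _ _) j0 => j j0.
have h0 : 0 <= 2 * b ^+ 2 * q by rewrite mulr_ge0 // mulr_ge0 // sqr_ge0.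
have h1 : 0 <= (- 2 - j) * q' by rewrite mulr_ge0; lia.
have h2 : 0 <= (- j) * p' by rewrite mulr_ge0; lia.
have h3 := mul_pred_ge0 j.
lia.
Qed.

Variable N : int.
Hypothesis N0 : 0 <= N.
(** From this bound on, an image coordinate pushes each preimage coordinate of positive slope up to
    at least [N]. *)
Definition raise_threshold := b ^+ 2 * (N + 1) + b * g + g * (g + 1) + 1.

Let bb0 : 0 < b ^+ 2. Proof. exact: exprn_gt0. Qed.

Let threshold_ge0 : 0 <= raise_threshold.
Proof.
rewrite /raise_threshold; have := ltW b0; have := ltW bb0.
by move=> h1 h2; rewrite !addr_ge0 // mulr_ge0 // addr_ge0.
Qed.

Lemma scaled_large_l p q p' q' (j : int) : scaled p q p' q' -> j = defect p q p' q' ->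
  0 <= j < b -> raise_threshold <= p' -> 0 <= q' -> N <= p /\ (j = 0 \/ N <= q).
Proof.
move=> e ej /andP[j0 jb] p'N q'0; have ep := scaled_p e ej; have eq := scaled_q e ej.
have p'0 := le_trans threshold_ge0 p'N; rewrite /raise_threshold in p'N.
have j1 : 0 <= b - j - 1 by lia.
have bg : 0 <= b * g by rewrite mulr_ge0 // ltW.
have h1 := mulr_ge0 j1 p'0; have h2 := mulr_ge0 j1 q'0; have h3 := mul_pred_ge0 j.
have h4 : 0 <= b * (b - j) by rewrite mulr_ge0 //; lia.
split; first by rewrite -(ler_pM2l bb0); lia.
have [->|{}j1] : j = 0 \/ 1 <= j by lia.
  by left.
have h5 : 0 <= (j - 1) * p' by rewrite mulr_ge0 // subr_ge0.
have h6 := mulr_ge0 j0 q'0.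
have h7 : 0 <= (b - j) * (b + j) by rewrite mulr_ge0 //; lia.
by right; rewrite -(ler_pM2l bb0); lia.
Qed.

(** The slopes in [q'] are proportional to [b - j - 1] and [j + 1], whence the two exceptions. *)
Lemma scaled_large_r p q p' q' (j : int) : scaled p q p' q' -> j = defect p q p' q' ->
  -1 <= j < b -> raise_threshold <= q' -> 0 <= p' ->
  (j = b - 1 \/ N <= p) /\ (j = -1 \/ N <= q).
Proof.
move=> e ej /andP[j0 jb] q'N p'0; have ep := scaled_p e ej; have eq := scaled_q e ej.
have q'0 := le_trans threshold_ge0 q'N; rewrite /raise_threshold in q'N.
have bg : 0 <= b * g by rewrite mulr_ge0 // ltW.
have h3 := mul_pred_ge0 j.
have h4 : 0 <= b * (b - j) by rewrite mulr_ge0 //; lia.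
split.
  have [->|j1] : j = b - 1 \/ j <= b - 2 by lia.
    by left.
  have h1 : 0 <= (b - j - 2) * q' by rewrite mulr_ge0 //; lia.
  have h2 : 0 <= (b - j) * p' by rewrite mulr_ge0 //; lia.
  by right; rewrite -(ler_pM2l bb0); lia.
have [->|j1] : j = -1 \/ 0 <= j by lia.
  by left.
have h1 := mulr_ge0 j1 p'0; have h2 := mulr_ge0 j1 q'0.
have h7 : 0 <= (b - j) * (b + j) by rewrite mulr_ge0 //; lia.
by right; rewrite -(ler_pM2l bb0); lia.
Qed.

End OddSquare.

(** * The case of one letter *)

Lemma value1 (c : 'I_1 -> nat) : value c = c ord0.
Proof.
by rewrite /value big_ord1 /multichoose subn0 bin1 addn0 /tail big_mkcond big_ord1.
Qed.

Lemma rec_set_scale1 lambda (Z : set ('I_1 -> nat)) : 0 < lambda -> rec_set Z ->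
  rec_set [set c : 'I_1 -> nat | exists2 c', Z c' & value c = lambda * value c'].
Proof.
move=> l0 [N [T [T0 per]]]; exists (lambda * N), (lambda * T); split.
  by rewrite muln_gt0 l0.
have ord0E (i : 'I_1) : i = ord0 by apply/ord_inj; case: i => [[]].
have value_raise (c : 'I_1 -> nat) t : value (raise c ord0 t) = value c + t.
  by rewrite !value1 /raise eqxx mul1n.
move=> c a; rewrite (ord0E a) => cN; split=> -[c' Zc' e].
  exists (raise c' ord0 T); last by rewrite !value_raise mulnDr e.
  have [h _] : Z c' <-> Z (raise c' ord0 T); last exact: h.
  by apply: per; rewrite -(leq_pmul2l l0) -[c' _]value1 -e value1.
have c'T : N + T <= c' ord0.
  by rewrite -(leq_pmul2l l0) -[c' _]value1 -e value_raise value1 mulnDr leq_add2r.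
exists (fun=> c' ord0 - T); last first.
  by rewrite (value1 (fun=> _ - _)) mulnBr -[c' _]value1 -e value_raise addnK.
rewrite (per _ ord0); last by lia.
move: Zc'; congr Z; apply/funext => i; rewrite (ord0E i) /raise eqxx; lia.
Qed.

(** * Exponent pairs, for two letters *)

Definition pair2 p q : 'I_2 -> nat := fun i => if i == ord0 then p else q.

Lemma pair2E (c : 'I_2 -> nat) : c = pair2 (c ord0) (c ord_max).
Proof.
apply/funext => i; rewrite /pair2; case: eqP => [->//|i0]; congr c.
by apply/ord_inj => /=; case: i i0 => [[|[|]]] //= ? h; case: h; apply/ord_inj.
Qed.

Lemma value_pair2 p q : 2 * value (pair2 p q) = (p + q) * (p + q + 1) + 2 * q.
Proof.
have t0 : tail (pair2 p q) 0 = p + q.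
  by rewrite /tail big_mkcond !big_ord_recl big_ord0 /pair2 /= addn0.
have t1 : tail (pair2 p q) 1 = q.
  by rewrite /tail big_mkcond !big_ord_recl big_ord0 /pair2 /= addn0.
rewrite /value !big_ord_recl big_ord0 /= t0 t1 addn0 mulnDr.
congr (_ + _); last by rewrite /multichoose bin1 addn0.
by rewrite -[2 in LHS]/(2`!) fact_multichoose !big_ord_recl big_ord0 /= muln1 addn0.
Qed.

Lemma rec_set2P (Z : set ('I_2 -> nat)) : rec_set Z <->
  exists N T, [/\ 0 < T,
    forall p q, N <= p -> (Z (pair2 p q) <-> Z (pair2 (p + T) q)) &
    forall p q, N <= q -> (Z (pair2 p q) <-> Z (pair2 p (q + T)))].
Proof.
have raise0 p q t : raise (pair2 p q) ord0 t = pair2 (p + t) q.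
  by apply/funext => i; rewrite /raise /pair2; case: eqP => _ /=; lia.
have raise1 p q t : raise (pair2 p q) ord_max t = pair2 p (q + t).
  apply/funext => i; rewrite /raise /pair2.
  by case: i => [[|[|]]] //= h; lia.
split=> -[N [T]].
  move=> [T0 per]; exists N, T; split=> // p q pN.
    by rewrite -raise0; apply: per.
  by rewrite -raise1; apply: per.
move=> [T0 per0 per1]; exists N, T; split=> // c a.
rewrite (pair2E c); set p := c ord0; set q := c ord_max.
have [->|->] : a = ord0 \/ a = ord_max.
    by case: a => [[|[|]]] //= h; [left | right]; apply/ord_inj.
  by rewrite raise0; apply: per0.
by rewrite raise1; apply: per1.
Qed.

Section ScaleOddSquare.
Variables (b g : nat).
Hypothesis bE : b = 2 * g + 1.

Let bE' : (b : int) = (2 * g%:Z + 1)%R. Proof. by rewrite bE; lia. Qed.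

Let scaledE p q p' q' :
  value (pair2 p' q') = b ^ 2 * value (pair2 p q) <-> scaled b p q p' q'.
Proof.
have e1 := value_pair2 p q; have e2 := value_pair2 p' q'.
rewrite /scaled; split=> [e|e].
  have {e} : 2 * value (pair2 p' q') = b ^ 2 * (2 * value (pair2 p q)).
    by rewrite e mulnCA.
  by rewrite e1 e2 -mulnn; lia.
apply/eqP; rewrite -(eqn_pmul2l (isT : 0 < 2)) mulnCA e1 e2; apply/eqP.
by rewrite -mulnn; lia.
Qed.

Lemma rec_set_scale2 (Z : set ('I_2 -> nat)) : rec_set Z ->
  rec_set [set c : 'I_2 -> nat | exists2 c', Z c' & value c = b ^ 2 * value c'].
Proof.
move=> /rec_set2P[N [T [T0 per0 per1]]]; apply/rec_set2P.
(* A coordinate of slope zero does not move, so no lower bound is asked of it. *)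
have mul0 p q k : (k = 0 \/ N <= p) -> Z (pair2 p q) <-> Z (pair2 (p + k * T) q).
  case=> [->|pN]; first by rewrite addn0.
  elim: k => [|k IH]; first by rewrite addn0.
  by rewrite IH per0 ?mulSn ?[T + _]addnC ?addnA // (leq_trans pN) ?leq_addr.
have mul1 p q k : (k = 0 \/ N <= q) -> Z (pair2 p q) <-> Z (pair2 p (q + k * T)).
  case=> [->|qN]; first by rewrite addn0.
  elim: k => [|k IH]; first by rewrite addn0.
  by rewrite IH per1 ?mulSn ?[T + _]addnC ?addnA // (leq_trans qN) ?leq_addr.
pose N' := b ^ 2 * (N + 1) + b * g + g * (g + 1) + 1.
have N'E : (N' : int) = raise_threshold b g N.
  by rewrite /N' /raise_threshold -mulnn; lia.
have gN m : N' <= m -> (g%:Z * (g%:Z + 1) < m)%R by rewrite /N'; lia.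
have thresholdP m : N' <= m -> (raise_threshold b g N <= m)%R by rewrite -N'E.
have bbE : Posz (b ^ 2) = (Posz b ^+ 2)%R by rewrite -mulnn; lia.
have g0 : (0 <= g%:Z)%R by [].
have N0 : (0 <= N%:Z)%R by [].
have natP (m : int) : (0 <= m)%R -> exists k : nat, (k : int) = m.
  by move=> m0; exists `|m|%N; lia.
have b0 : 0 < b by lia.
have swap (W : set ('I_2 -> nat)) : [set c : 'I_2 -> nat | exists2 c', W c' & value c = b ^ 2 * value c'] =
   [set c : 'I_2 -> nat | exists p q, W (pair2 p q) /\ value c = b ^ 2 * value (pair2 p q)].
  apply/seteqP; split=> c /=.
    by move=> [c' Wc' e]; exists (c' ord0), (c' ord_max); rewrite -pair2E.
  by move=> [p [q [Wpq e]]]; exists (pair2 p q).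
rewrite swap; exists N', (b ^ 2 * T); split; first by rewrite muln_gt0 T0 expn_gt0 b0.
- move=> p' q' p'N; split=> -[p [q [Zpq /scaledE e]]].
    have jb := defect_lt g0 bE' e isT isT isT isT.
    have j0 := defect_ge0 g0 bE' e isT isT isT (gN _ p'N).
    have [j ej] := natP _ j0; rewrite -ej in jb j0.
    have [|pN qN] := scaled_large_l g0 bE' N0 e ej _ (thresholdP _ p'N) isT.
      by rewrite j0.
    have [u uE] : exists u, u + j = b by exists (b - j); lia.
    exists (p + u * T), (q + j * T); split.
      have h0 : u = 0 \/ N <= p by right.
      have h1 : j = 0 \/ N <= q by lia.
      exact: (mul1 _ _ _ h1).1 ((mul0 _ _ _ h0).1 Zpq).
    apply/scaledE; rewrite !PoszD (PoszM (b ^ 2)) bbE !PoszM (_ : Posz u = Posz b - Posz j)%R; last lia.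
    exact/(scaled_raise_l bE' _ ej).
  rewrite PoszD PoszM bbE in e.
  have p'N' : N' <= p' + b ^ 2 * T by rewrite (leq_trans p'N) // leq_addr.
  have pos : (0 <= Posz p' + Posz b ^+ 2 * Posz T)%R by rewrite -bbE -PoszM -PoszD.
  have jb := defect_lt g0 bE' e isT isT pos isT.
  have j0 : (0 <= defect b g p q (Posz p' + Posz b ^+ 2 * Posz T) q')%R.
    by apply: defect_ge0 e _ _ _ _ => //; rewrite -bbE -PoszM -PoszD; apply: gN.
  have [j ej] := natP _ j0; rewrite -ej in jb j0.
  have [u uE] : exists u, u + j = b by exists (b - j); lia.
  (* The preimage is lowered in the integers: that [p0] and [q0] are not negative follows only
     later, from [scaled_large_l] or from a zero slope. *)
  have [p0 ep0] : exists p0 : int, (Posz p = p0 + (Posz b - Posz j) * Posz T)%R.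
    by exists (Posz p - (Posz b - Posz j) * Posz T)%R; lia.
  have [q0 eq0] : exists q0 : int, (Posz q = q0 + Posz j * Posz T)%R.
    by exists (Posz q - Posz j * Posz T)%R; lia.
  have ej0 : (Posz j = defect b g p0 q0 p' q')%R.
    by rewrite ej ep0 eq0 /defect; lia.
  have e0 : scaled b p0 q0 p' q'.
    by apply/(scaled_raise_l bE' T ej0); rewrite -ep0 -eq0.
  have [|pN qN] := scaled_large_l g0 bE' N0 e0 ej0 _ (thresholdP _ p'N) isT.
    by rewrite j0.
  have ep0' : (Posz p = p0 + Posz u * Posz T)%R by rewrite ep0 -uE PoszD addrK.
  have eq0' := eq0.
  have uN : u = 0 \/ (Posz N <= p0)%R by right.
  have jN : j = 0 \/ (Posz N <= q0)%R by clear -qN; lia.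
  have [p1 ep1] : exists p1, Posz p1 = p0 by apply: natP; apply: le_trans N0 pN.
  have [q1 eq1] : exists q1, Posz q1 = q0.
    apply: natP; case: jN => [j00|]; last exact: le_trans N0.
    by move: eq0'; rewrite j00 mul0r addr0 => <-.
  exists p1, q1; split; last by apply/scaledE; rewrite ep1 eq1.
  have h0 : u = 0 \/ N <= p1 by clear -uN ep1; lia.
  have h1 : j = 0 \/ N <= q1 by clear -jN eq1; lia.
  apply: (mul0 _ _ _ h0).2; apply: (mul1 _ _ _ h1).2.
  have -> : p1 + u * T = p by apply/eqP; rewrite -eqz_nat PoszD PoszM ep1 -ep0'.
  by have -> : q1 + j * T = q by apply/eqP; rewrite -eqz_nat PoszD PoszM eq1 -eq0'.
move=> p' q' q'N; split=> -[p [q [Zpq /scaledE e]]].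
  have jb := defect_lt g0 bE' e isT isT isT isT.
  have j0 := defect_geN1 g0 bE' e isT isT isT (gN _ q'N).
  have [d ed] : exists d : int, d = defect b g p q p' q' by exists (defect b g p q p' q').
  rewrite -ed in jb j0.
  have [|pN qN] := scaled_large_r g0 bE' N0 e ed _ (thresholdP _ q'N) isT.
    by rewrite j0.
  (* The defect [d] may be [-1] here; the slopes [d + 1] of [q] and [b - d - 1] of [p] are still
     natural numbers. *)
  have [j ej] : exists j, Posz j = (d + 1)%R by apply: natP; lia.
  have [u uE] : exists u, u + j = b by exists (b - j); lia.
  exists (p + u * T), (q + j * T); split.
    have h0 : u = 0 \/ N <= p by lia.
    have h1 : j = 0 \/ N <= q by lia.
    exact: (mul1 _ _ _ h1).1 ((mul0 _ _ _ h0).1 Zpq).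
  apply/scaledE; rewrite !PoszD (PoszM (b ^ 2)) bbE !PoszM (_ : Posz u = Posz b - d - 1)%R; last lia.
  rewrite ej; exact/(scaled_raise_r bE' _ ed).
rewrite PoszD PoszM bbE in e.
have q'N' : N' <= q' + b ^ 2 * T by rewrite (leq_trans q'N) // leq_addr.
have pos : (0 <= Posz q' + Posz b ^+ 2 * Posz T)%R by rewrite -bbE -PoszM -PoszD.
have jb := defect_lt g0 bE' e isT isT isT pos.
have j0 : (-1 <= defect b g p q p' (Posz q' + Posz b ^+ 2 * Posz T))%R.
  by apply: defect_geN1 e _ _ _ _ => //; rewrite -bbE -PoszM -PoszD; apply: gN.
have [d ed] : exists d : int, d = defect b g p q p' (Posz q' + Posz b ^+ 2 * Posz T)%R.
  by exists (defect b g p q p' (Posz q' + Posz b ^+ 2 * Posz T)%R).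
rewrite -ed in jb j0.
have [j ej] : exists j, Posz j = (d + 1)%R by apply: natP; lia.
have [u uE] : exists u, u + j = b by exists (b - j); lia.
have [p0 ep0] : exists p0 : int, (Posz p = p0 + (Posz b - d - 1) * Posz T)%R.
  by exists (Posz p - (Posz b - d - 1) * Posz T)%R; lia.
have [q0 eq0] : exists q0 : int, (Posz q = q0 + (d + 1) * Posz T)%R.
  by exists (Posz q - (d + 1) * Posz T)%R; lia.
have ed0 : (d = defect b g p0 q0 p' q')%R.
  by rewrite ed ep0 eq0 /defect; lia.
have e0 : scaled b p0 q0 p' q'.
  by apply/(scaled_raise_r bE' T ed0); rewrite -ep0 -eq0.
have [|pN qN] := scaled_large_r g0 bE' N0 e0 ed0 _ (thresholdP _ q'N) isT.
  by rewrite j0.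
have ep0' : (Posz p = p0 + Posz u * Posz T)%R.
  by rewrite ep0; congr (_ + _ * _)%R; clear -uE ej; lia.
have eq0' : (Posz q = q0 + Posz j * Posz T)%R by rewrite ej.
have uN : u = 0 \/ (Posz N <= p0)%R by clear -uE ej pN; lia.
have jN : j = 0 \/ (Posz N <= q0)%R by clear -ej qN; lia.
have [p1 ep1] : exists p1, Posz p1 = p0.
  apply: natP; case: uN => [u0|]; last exact: le_trans N0.
  by move: ep0'; rewrite u0 mul0r addr0 => <-.
have [q1 eq1] : exists q1, Posz q1 = q0.
  apply: natP; case: jN => [j00|]; last exact: le_trans N0.
  by move: eq0'; rewrite j00 mul0r addr0 => <-.
exists p1, q1; split; last by apply/scaledE; rewrite ep1 eq1.
have h0 : u = 0 \/ N <= p1 by clear -uN ep1; lia.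
have h1 : j = 0 \/ N <= q1 by clear -jN eq1; lia.
apply: (mul0 _ _ _ h0).2; apply: (mul1 _ _ _ h1).2.
have -> : p1 + u * T = p by apply/eqP; rewrite -eqz_nat PoszD PoszM ep1 -ep0'.
by have -> : q1 + j * T = q by apply/eqP; rewrite -eqz_nat PoszD PoszM eq1 -eq0'.
Qed.

End ScaleOddSquare.

(** * Other multipliers, two letters *)

(** For [s <> r] the squares would differ by at least [s + r >= r > |e|]. *)
Lemma close_squares (r s e : int) :
  (0 <= s)%R -> (`|e| < r)%R -> (s ^+ 2 - r ^+ 2 = e)%R -> e = 0%R.
Proof.
move=> s0 /[swap] <- er; have r0 := le_lt_trans (normr_ge0 _) er.
have sr0 : (0 <= s + r)%R by rewrite addr_ge0 // ltW.
move: er; rewrite ltr_norml => /andP[er1 er2].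
have [sr|sr|->] := ltgtP s r; last by rewrite subrr.
  have : (0 <= (r - s - 1) * (s + r))%R by apply: mulr_ge0 => //; lia.
  by lia.
have : (0 <= (s - r - 1) * (s + r))%R by apply: mulr_ge0 => //; lia.
by lia.
Qed.

(* [lambda ^ 2 * N_k ^ 2 * N_(k+1) ^ 2] is the square of [A_k * A_(k+1) + C] plus
   [4 * C * T ^ 2], where [N_k = 2 * n_k + 1] and [A_k = 2 * k * T + u]; two large
   squares at bounded distance coincide, so [C = 0]. *)
Lemma square_progression (lambda T u : nat) (C : int) (n : nat -> nat) :
  0 < T -> odd u ->
  (forall k, Posz lambda * (Posz (2 * n k + 1)) ^+ 2 =
    (Posz (2 * (k * T) + u)) ^+ 2 + C)%R ->
  exists b, odd b /\ lambda = b ^ 2.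
Proof.
move=> T0 odd_u eqn.
have C0 : C = 0%R.
  pose E : int := (4 * C * Posz T ^+ 2)%R.
  (* As [r >= k ^ 2 - |C|], this [k] makes [r] exceed [|E|]. *)
  pose k := `|C| + `|E| + 1.
  have := eqn k; have := eqn k.+1.
  set x := Posz (2 * n k.+1 + 1); set y := Posz (2 * n k + 1).
  have -> : Posz (2 * (k.+1 * T) + u) = (Posz (2 * (k * T) + u) + 2 * Posz T)%R.
    by rewrite mulSn; lia.
  set a := Posz (2 * (k * T) + u) => ex ey.
  have ka : (Posz k <= a)%R.
    by rewrite /a lez_nat; have := leq_pmulr k T0; clear; lia.
  pose s := (Posz lambda * x * y)%R; pose r := (a * (a + 2 * Posz T) + C)%R.
  have sr : (s ^+ 2 - r ^+ 2 = E)%R.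
    rewrite (_ : s ^+ 2 = (Posz lambda * x ^+ 2) * (Posz lambda * y ^+ 2))%R; last first.
      by rewrite /s; ring.
    by rewrite ex ey /r /E; ring.
  have s0 : (0 <= s)%R by [].
  have rk : (`|E| < r)%R.
    have k0 : (0 <= Posz k)%R by [].
    have ka2 : (Posz k <= a + 2 * Posz T)%R by rewrite (le_trans ka) // lerDl.
    have kk := ler_pM k0 k0 ka ka2.
    have k1 : (Posz k <= Posz k * Posz k)%R by rewrite -PoszM lez_nat leq_pmulr // /k addn1.
    have kE : Posz k = (Posz `|C| + Posz `|E| + 1)%R by [].
    by rewrite /r -abszE; clear -kk k1 kE; lia.
  have E0 : E = 0%R := close_squares s0 rk sr.
  have T2 : (Posz T ^+ 2 != 0)%R by rewrite expf_neq0 // eqz_nat -lt0n.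
  have : (4 * C = 0)%R by apply: (mulIf T2); rewrite mul0r.
  by clear; lia.
have := eqn 0; rewrite C0 addr0 mul0n muln0 add0n.
set m := 2 * n 0 + 1 => /eqP.
have -> : (Posz lambda * Posz m ^+ 2 = Posz (lambda * (m * m)))%R by [].
have -> : (Posz u ^+ 2 = Posz (u * u))%R by [].
rewrite eqz_nat => /eqP e.
have /dvdnP[b ub] : m %| u by rewrite -(@dvdn_pexp2r _ _ 2) // -[u ^ 2]/(u * u) -e dvdn_mull.
exists b; split; first by move: odd_u; rewrite ub oddM => /andP[].
have m0 : 0 < m * m by rewrite muln_gt0 /m addn1.
by apply/eqP; rewrite -(eqn_pmul2r m0) e ub -mulnn mulnACA.
Qed.

Lemma mul_preserves2_odd_square lambda : 0 < lambda ->
  mul_preserves_recognizable (bounded_lang 2) lambda ->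
  exists b, odd b /\ lambda = b ^ 2.
Proof.
move=> l0 /mul_preservesP => /(_ isT) pres.
pose Z : set ('I_2 -> nat) := [set c | c ord_max = 0].
pose W : set ('I_2 -> nat) := [set c | exists2 c', Z c' & value c = lambda * value c'].
have /rec_set2P[N [T [T0 per0 per1]]] : rec_set W.
  by apply: pres; apply/rec_set2P; exists 1, 1; split=> // p q; rewrite /Z /pair2 /=; lia.
(* The word of this value has length at least [2 * N], so one of its exponents is at least [N] and
   can be pumped. *)
have [c ec] := @value_surj 2 (lambda * value (pair2 (2 * N) 0)) isT.
rewrite (pair2E c) in ec; set p := c ord0 in ec; set q := c ord_max in ec.
have img : W (pair2 p q) by exists (pair2 (2 * N) 0).
have imgE p' q' : W (pair2 p' q') ->
    exists n, (p' + q') * (p' + q' + 1) + 2 * q' = lambda * (n * (n + 1)).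
  move=> [c']; rewrite (pair2E c') /Z /= => c'0 e.
  exists (c' ord0); rewrite -value_pair2 e mulnCA value_pair2.
  by move: c'0; rewrite /pair2 /= => ->; rewrite muln0 !addn0.
have [pN|pN] := leqP N p.
  have per k : exists n, (p + k * T + q) * (p + k * T + q + 1) + 2 * q = lambda * (n * (n + 1)).
    apply: imgE; elim: k => [|k IH]; first by rewrite mul0n addn0.
    have h : N <= p + k * T by rewrite (leq_trans pN) ?leq_addr.
    by rewrite mulSn [T + _]addnC addnA; exact: (per0 _ _ h).1.
  have [n en] := choice per.
  (* For a word of length [s], [4 * (s * (s + 1) + 2 * q) = (2 * s + 1) ^ 2 - 1 + 8 * q], and [q]
     stays fixed. *)
  apply: (@square_progression lambda T (2 * (p + q) + 1) (8 * Posz q + Posz lambda - 1)%R n) => //.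
    by rewrite addn1 /= mul2n odd_double.
  move=> k; have := en k; lia.
have [qN|qN] := leqP N q.
  have per k : exists n, (p + (q + k * T)) * (p + (q + k * T) + 1) + 2 * (q + k * T) =
      lambda * (n * (n + 1)).
    apply: imgE; elim: k => [|k IH]; first by rewrite mul0n addn0.
    have h : N <= q + k * T by rewrite (leq_trans qN) ?leq_addr.
    by rewrite mulSn [T + _]addnC addnA; exact: (per1 _ _ h).1.
  have [n en] := choice per.
  (* Now [p] is fixed, and [s * (s + 1) + 2 * q = s * (s + 3) - 2 * p], whence the shift [3]. *)
  apply: (@square_progression lambda T (2 * (p + q) + 3) (Posz lambda - 9 - 8 * Posz p)%R n) => //.
    by rewrite addn3 /= negbK mul2n odd_double.
  move=> k; have := en k; lia.
have : (p + q) * (p + q + 1) + 2 * q = lambda * (2 * value (pair2 (2 * N) 0)).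
  by rewrite -value_pair2 ec mulnCA.
rewrite value_pair2; have : p + q < 2 * N by lia.
nia.
Qed.

(** * Integer sequences solving polynomial equations *)

Section PolynomialGrowth.
Local Open Scope ring_scope.
Variable R : archiRealFieldType.
Implicit Types (p : {poly R}) (a : nat -> R).

Lemma eventually_horner_gt0 p d : (size p <= d.+1)%N -> 0 < p`_d ->
  exists K, forall k, (K <= k)%N -> 0 < p.[k%:R].
Proof.
move=> sp pd; have sizep : size p = d.+1.
  apply/eqP; rewrite eqn_leq sp ltnNge; apply: contraTN pd => /leq_sizeP.
  by move=> /(_ d (leqnn d)) ->; rewrite ltxx.
have lp : 0 < lead_coef p by rewrite lead_coefE sizep.
have [x px] := poly_pinfty_gt_lc lp.
exists (Num.bound `|x|) => k xk; apply: lt_le_trans lp (px _ _).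
apply: le_trans (ler_norm x) (le_trans (ltW (archi_boundP (normr_ge0 _))) _).
by rewrite ler_nat.
Qed.

(** Products with equal [n] and [s] share their leading coefficient, so comparing two of them comes
    down to the sums of the offsets [a j], through the second coefficient. *)
Definition linear_prod n (s : R) a : {poly R} := \prod_(j < n) (s *: 'X + (a j)%:P).

Lemma horner_linear_prod n s a x :
  (linear_prod n s a).[x] = \prod_(j < n) (s * x + a j).
Proof. by rewrite horner_prod; apply: eq_bigr => j _; rewrite !hornerE. Qed.

Lemma coef_linear_prodS n s a i : (linear_prod n.+1 s a)`_i =
  (if i is i'.+1 then s * (linear_prod n s a)`_i' else 0) + a n * (linear_prod n s a)`_i.
Proof.
rewrite /linear_prod big_ord_recr /= -/(linear_prod n s a) mulrDr coefD.
rewrite -scalerAr coefZ coefMX coefMC mulrC; congr (_ + _); last exact: mulrC.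
by case: i => [|i]; rewrite ?mul0r //= mulrC.
Qed.

Lemma size_linear_prod n s a : (size (linear_prod n s a) <= n.+1)%N.
Proof.
apply/leq_sizeP; elim: n => [|n IH] j nj.
  by rewrite /linear_prod big_ord0 coef1; case: j nj.
by rewrite coef_linear_prodS; case: j nj => // j nj; rewrite !IH ?mulr0 ?addr0 //; lia.
Qed.

Lemma coef_linear_prod n s a : (linear_prod n s a)`_n = s ^+ n.
Proof.
elim: n => [|n IH]; first by rewrite /linear_prod big_ord0 coef1.
by rewrite coef_linear_prodS IH exprS (leq_sizeP _ _ (size_linear_prod n s a)) ?mulr0 ?addr0.
Qed.

Lemma coef_linear_prod_pred n s a :
  (linear_prod n.+1 s a)`_n = s ^+ n * \sum_(j < n.+1) a j.
Proof.
elim: n => [|n IH].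
  by rewrite coef_linear_prodS big_ord1 (coef_linear_prod 0) add0r mulrC.
rewrite coef_linear_prodS IH coef_linear_prod [in RHS]big_ord_recr /= mulrDr exprS mulrA.
by congr (_ + _); rewrite mulrC.
Qed.

Lemma size_linear_prodB n s a a' :
  (size (linear_prod n s a - linear_prod n s a')%R <= n)%N.
Proof.
apply/leq_sizeP => j nj; rewrite coefB.
have [->|{}nj] : j = n \/ (n < j)%N by lia.
  by rewrite !coef_linear_prod subrr.
by rewrite !(leq_sizeP _ _ (size_linear_prod _ _ _)) ?subr0.
Qed.

Lemma coef_linear_prodB n s a a' : (linear_prod n.+1 s a - linear_prod n.+1 s a')`_n =
  s ^+ n * (\sum_(j < n.+1) a j - \sum_(j < n.+1) a' j).
Proof. by rewrite coefB !coef_linear_prod_pred -mulrBr. Qed.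

Lemma coef_shift1 p i n : (size p <= n)%N ->
  (p \Po ('X + 1))`_i = \sum_(j < n) p`_j * 'C(j, i)%:R.
Proof.
move=> pn; rewrite poly.coef_comp_poly.
rewrite (big_ord_widen n (fun j => p`_j * (('X + 1) ^+ j)`_i)) //.
rewrite big_mkcond; apply: eq_bigr => j _; case: ltnP => [_|sj]; last first.
  by rewrite nth_default // mul0r.
congr (_ * _); rewrite exprD1n coef_sum.
under eq_bigr do rewrite coefMn coefXn.
have [ij|ij] := leqP i j; last first.
  rewrite bin_small // big1 // => k _; case: eqP => [ik|_]; last by rewrite mul0rn.
  by have := ltn_ord k; rewrite -ik ltnS leqNgt ij.
rewrite (bigD1 (Ordinal (ij : (i < j.+1)%N))) //= eqxx big1 ?addr0 // => k.
by rewrite -val_eqE /= eq_sym => /negPf ->; rewrite mul0rn.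
Qed.

Lemma size_shift1B p n : (size p <= n.+1)%N ->
  (size (p \Po ('X + 1) - p)%R <= n)%N.
Proof.
move=> sp; apply/leq_sizeP => i ni; rewrite coefB (coef_shift1 i sp).
have [->|{}ni] : i = n \/ (n < i)%N by lia.
  rewrite big_ord_recr /= binn mulr1 big1 ?add0r ?subrr // => j _.
  by rewrite bin_small // mulr0.
rewrite (leq_sizeP _ _ sp) // subr0 big1 // => j _.
by rewrite bin_small ?mulr0 // (leq_trans (ltn_ord j)).
Qed.

Lemma coef_shift1B p n : (size p <= n.+2)%N ->
  (p \Po ('X + 1) - p)`_n = n.+1%:R * p`_n.+1.
Proof.
move=> sp; rewrite coefB (coef_shift1 n sp) !big_ord_recr /= binn binSn mulr1.
rewrite big1 => [|j _]; last by rewrite bin_small // mulr0.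
by rewrite add0r addrAC subrr add0r mulrC.
Qed.

(** This extends [n! * multichoose n x] to real [x]. *)
Definition rising n (x : R) : R := \prod_(j < n) (x + j%:R).

Lemma ler_rising n x y : 0 <= x -> x <= y -> rising n x <= rising n y.
Proof.
move=> x0 xy; apply: ler_prod => j _.
by rewrite addr_ge0 //= lerD2r.
Qed.

(** Convexity on nonnegative arguments, by induction on the factors: in [factor] both summands grow
    with the base point. *)
Lemma ler_risingB n x y t : 0 <= x -> x <= y -> 0 <= t ->
  rising n (x + t) - rising n x <= rising n (y + t) - rising n y.
Proof.
move=> x0 xy t0; have y0 := le_trans x0 xy.
elim: n => [|n IH]; first by rewrite /rising !big_ord0.
rewrite /rising !big_ord_recr /= -/(rising n _) -/(rising n x) -/(rising n y) -/(rising n (y + t)).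
have h0 : 0 <= rising n (x + t) - rising n x.
  by rewrite subr_ge0 ler_rising // lerDl.
have h1 := ler_rising n x0 xy.
have factor z : rising n (z + t) * (z + t + n%:R) - rising n z * (z + n%:R) =
  (rising n (z + t) - rising n z) * (z + t + n%:R) + rising n z * t by ring.
rewrite (factor x) (factor y); apply: lerD; last exact: ler_wpM2r.
by apply: ler_pM => //; rewrite ?addr_ge0 // !lerD2r.
Qed.

Lemma rising_linear n s c k :
  rising n (s * k + c) = (linear_prod n s (fun j => c + j%:R)).[k].
Proof.
by rewrite horner_linear_prod; apply: eq_bigr => j _; rewrite addrA.
Qed.


Lemma rising_gt n x y : 0 <= x -> rising n x < rising n y -> x < y \/ y < 0.
Proof.
move=> x0 xy; have [y0|] := lerP 0 y; last by right.
left; rewrite ltNge; apply/negP => /(ler_rising n y0).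
by rewrite leNgt xy.
Qed.

(* Since [z_k = rho * k + O(1)], the difference [z_(k+1) - z_k] is eventually
   larger than any integer below [rho] and smaller than any integer above it. *)
Lemma rising_sequence_slope d (A rho : R) (G : {poly R}) (z : nat -> nat) K0 :
  0 < A -> 0 < rho -> (size G <= d.+2)%N -> G`_d.+1 = A * rho ^+ d.+1 ->
  (forall k, (K0 <= k)%N -> A * rising d.+1 (z k)%:R = G.[k%:R]) ->
  exists n : nat, rho = n%:R.
Proof.
move=> A0 rho0 sG lG eqG; set D := d.+1.
have rd0 : 0 < rho ^+ d by apply: exprn_gt0.
pose lin c := linear_prod D rho (fun j => c + j%:R).
pose S : R := \sum_(j < D) j%:R.
have lin_size c : (size (A *: lin c) <= D.+1)%N.
  by apply: leq_trans (size_scale_leq _ _) (size_linear_prod _ _ _).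
have lin_coef c : (A *: lin c)`_D = A * rho ^+ D by rewrite coefZ coef_linear_prod.
have lin_coef_pred c : (A *: lin c)`_d = A * rho ^+ d * (D%:R * c + S).
  rewrite coefZ coef_linear_prod_pred -mulrA; congr (_ * (_ * _)).
  by rewrite big_split /= sumr_const card_ord mulr_natl.
have linE c k : (A *: lin c).[k%:R] = A * rising D (rho * k%:R + c).
  by rewrite hornerZ -rising_linear.
have sizeB (p q : {poly R}) : (size p <= D.+1)%N -> (size q <= D.+1)%N -> p`_D = q`_D ->
    (size (p - q)%R <= D)%N.
  move=> sp sq pq; apply/leq_sizeP => j Dj; rewrite coefB.
  have [->|{}Dj] : j = D \/ (D < j)%N by lia.
    by rewrite pq subrr.
  by rewrite (leq_sizeP _ _ sp) // (leq_sizeP _ _ sq) // subrr.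
(* With this [C], the coefficients of degree [d] of [A *: lin (- C)] and [A *: lin C] lie on either
   side of that of [G], while the leading ones agree. This eventually confines [z k] to within [C]
   of [rho * k]. *)
pose C : R := (Num.bound `|(G`_d / (A * rho ^+ d) - S)|)%:R.
have Ar0 : 0 < A * rho ^+ d by apply: mulr_gt0.
have C0 : 0 <= C by rewrite ler0n.
have C_gt : `|G`_d / (A * rho ^+ d) - S| < D%:R * C.
  apply: lt_le_trans (archi_boundP (normr_ge0 _)) _.
  by rewrite ler_peMl // ler1n.
have [K1 zK1] : exists K, forall k, (K <= k)%N -> (z k)%:R < rho * k%:R + C.
  have [||K pK] := @eventually_horner_gt0 (A *: lin C - G) d.
  - by apply: sizeB; rewrite ?lin_coef.
  - rewrite coefB lin_coef_pred subr_gt0 -ltr_pdivrMl // [_^-1 * _]mulrC -ltrBlDr.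
    exact: le_lt_trans (ler_norm _) C_gt.
  exists (maxn K K0) => k; rewrite geq_max => /andP[Kk K0k].
  have := pK k Kk; rewrite hornerD hornerN subr_gt0 -eqG // linE ltr_pM2l //.
  case/(rising_gt (ler0n _ _)) => // neg.
  by have := lt_le_trans neg (ler0n _ 0); rewrite ltNge addr_ge0 // mulr_ge0 // ltW.
have [K2 zK2] : exists K, forall k, (K <= k)%N -> 0 <= rho * k%:R - C /\ rho * k%:R - C < (z k)%:R.
  have [||K pK] := @eventually_horner_gt0 (G - A *: lin (- C)) d.
  - by apply: sizeB; rewrite ?lin_coef.
  - rewrite coefB lin_coef_pred subr_gt0 -ltr_pdivlMl // [_^-1 * _]mulrC.
    move: C_gt; rewrite ltr_norml => /andP[]; lra.
  have Cr0 : 0 <= C / rho by rewrite divr_ge0 // ltW.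
  exists (maxn (maxn K K0) (Num.bound (C / rho))) => k.
  rewrite !geq_max => /andP[/andP[Kk K0k] bk].
  have y0 : 0 <= rho * k%:R - C.
    rewrite subr_ge0 -ler_pdivrMl // mulrC.
    by apply: le_trans (ltW (archi_boundP Cr0)) _; rewrite ler_nat.
  split=> //; have := pK k Kk; rewrite hornerD hornerN subr_gt0 -eqG // linE ltr_pM2l //.
  by case/(rising_gt y0) => //; rewrite ltNge ler0n.
pose DG := G \Po ('X + 1) - G.
have sDG : (size DG <= D)%N by apply: size_shift1B.
have cDG : DG`_d = A * rho ^+ d * (D%:R * rho).
  by rewrite /DG coef_shift1B // lG exprSr; move: (rho ^+ d) D%:R => x y; ring.
have DGE k : (K0 <= k)%N ->
    DG.[k%:R] = A * rising D (z k.+1)%:R - A * rising D (z k)%:R.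
  by move=> Kk; rewrite hornerD hornerN horner_comp !hornerE natr1 -!eqG // leqW.
have lindiff_coef c t : (A *: (lin (c + t) - lin c))`_d = A * rho ^+ d * (D%:R * t).
  by rewrite scalerBr coefB !lin_coef_pred; ring.
have lindiff_size (c t : R) : (size (A *: (lin (c + t) - lin c))%R <= D)%N.
  by apply: leq_trans (size_scale_leq _ _) (size_linear_prodB _ _ _ _).
(* If [z] grew by at most [t] from [k] to [k.+1], convexity would bound [DG] at [k] by the increment
   from [rho * k + C] to [rho * k + C + t], whose coefficient of degree [d] is smaller because
   [t < rho]. *)
have up (t : nat) : t%:R < rho -> exists K, forall k, (K <= k)%N -> (z k + t < z k.+1)%N.
  move=> t_rho; have [||K pK] := @eventually_horner_gt0 (DG - A *: (lin (C + t%:R) - lin C)) d.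
  - by rewrite (leq_trans (size_polyD _ _)) // geq_max size_polyN sDG lindiff_size.
  - rewrite coefB lindiff_coef cDG subr_gt0.
    by rewrite ltr_pM2l // ltr_pM2l // ltr0n.
  exists (maxn K (maxn K1 K0)) => k; rewrite !geq_max => /and3P[Kk K1k K0k].
  rewrite ltnNge; apply/negP => zS; have := pK k Kk.
  rewrite hornerD hornerN subr_gt0 DGE // scalerBr hornerD hornerN !linE ltNge => /negP; apply.
  rewrite -!mulrBr ler_pM2l // addrA.
  apply: le_trans (ler_risingB _ (ler0n _ _) (ltW (zK1 k K1k)) (ler0n _ t)).
  by rewrite lerD2r ler_rising // -natrD ler_nat.
(* The same from the other side, convexity being applied at the lower barrier [rho * k - C]. *)
have down (t : nat) : rho < t%:R -> exists K, forall k, (K <= k)%N -> (z k.+1 < z k + t)%N.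
  move=> t_rho; have [||K pK] := @eventually_horner_gt0 (A *: (lin (- C + t%:R) - lin (- C)) - DG) d.
  - by rewrite (leq_trans (size_polyD _ _)) // geq_max size_polyN sDG lindiff_size.
  - rewrite coefB lindiff_coef cDG subr_gt0.
    by rewrite ltr_pM2l // ltr_pM2l // ltr0n.
  exists (maxn K (maxn K2 K0)) => k; rewrite !geq_max => /and3P[Kk K2k K0k].
  rewrite ltnNge; apply/negP => zS; have := pK k Kk.
  rewrite hornerD hornerN subr_gt0 DGE // scalerBr hornerD hornerN !linE ltNge => /negP; apply.
  rewrite -!mulrBr ler_pM2l // addrA; have [y0 yz] := zK2 k K2k.
  apply: le_trans (ler_risingB _ y0 (ltW yz) (ler0n _ t)) _.
  by rewrite lerD2r ler_rising // -natrD ?ler0n // ler_nat.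
(* If the floor [n] of [rho] were below [rho], both bounds would put [z k.+1 - z k] strictly between
   [n] and [n + 1]. *)
have /andP[n_le n_gt] := truncn_itv (ltW rho0).
exists (Num.truncn rho); apply/eqP; rewrite eq_le n_le andbT leNgt; apply/negP => n_lt.
have [K3 hK3] := up _ n_lt; have [K4 hK4] := down _ n_gt.
have := hK3 (maxn K3 K4) (leq_maxl _ _); have := hK4 (maxn K3 K4) (leq_maxr _ _).
lia.
Qed.

End PolynomialGrowth.

(** * Three letters or more *)

Section TailSums.
Variable l : nat.
Implicit Types c : 'I_l.+1 -> nat.

Lemma tail_recl c : tail c 0 = c ord0 + tail c 1.
Proof.
by rewrite /tail big_mkcond [in RHS]big_mkcond !big_ord_recl /= add0n.
Qed.

Lemma leq_tail c i : tail c i.+1 <= tail c i.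
Proof.
rewrite /tail big_mkcond [leqRHS]big_mkcond; apply: leq_sum => j _.
by case: ifP => // ij; rewrite (ltnW ij).
Qed.

Lemma tail_raise c t i : tail (raise c ord0 t) i = tail c i + (i == 0) * t.
Proof.
rewrite /tail big_split /=; congr (_ + _); rewrite -big_distrl /=; congr (_ * t).
rewrite big_mkcond big_ord_recl big1 ?addn0 => [|j _]; last by case: ifP.
by rewrite eqxx; case: i.
Qed.

Lemma value_bounds c :
  multichoose l.+1 (tail c 0) <= value c < multichoose l.+1 (tail c 0).+1.
Proof.
rewrite /value; apply/andP; split; first by rewrite big_ord_recl leq_addr.
rewrite -(big_mkord xpredT (fun i => multichoose (l.+1 - i) (tail c i))).
exact: sum_multichoose_lt (leq_tail c).
Qed.

End TailSums.

Lemma value_recl2 d (c : 'I_d.+3 -> nat) : value c =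
  multichoose d.+3 (tail c 0) + multichoose d.+2 (tail c 1) +
  \sum_(i < d.+1) multichoose (d.+1 - i) (tail c i.+2).
Proof. by rewrite /value !big_ord_recl addnA. Qed.

(** Modulo [D], the exponent of [2] is [1] on the left and [0] or [2] on the right; either way [D]
    would divide [1]. *)
Lemma no_power_ratio lambda delta h T D : 1 < D -> 0 < lambda -> 0 < T ->
  h = 3 \/ h = 4 -> 2 * lambda ^ D * delta ^ D <> h * T ^ D.
Proof.
move=> D1 l0 T0 h34 e.
have h0 : 0 < h by case: h34 => ->.
have hT : 0 < h * T ^ D by rewrite muln_gt0 h0 expn_gt0 T0.
have delta0 : 0 < delta.
  by move: hT; rewrite -e muln_gt0 expn_gt0 [D == 0]gtn_eqF ?orbF ?(ltnW D1) // => /andP[].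
have := congr1 (logn 2) e.
have ld0 : 0 < lambda * delta by rewrite muln_gt0 l0.
rewrite -mulnA -expnMn lognM ?expn_gt0 ?ld0 // [in RHS]lognM ?expn_gt0 ?T0 //.
rewrite !lognX => e'.
have : D %| 1.
  have [hE|hE] : logn 2 h = 0 \/ logn 2 h = 2 by case: h34 => ->; [left | right].
    rewrite -(dvdn_addl _ (dvdn_mulr (logn 2 (lambda * delta)) (dvdnn D))).
    by rewrite (_ : 1 = logn 2 2) // e' hE dvdn_mulr.
  rewrite -(dvdn_addl _ (dvdn_mulr (logn 2 T) (dvdnn D))).
  have -> : 1 + D * logn 2 T = D * logn 2 (lambda * delta).
    by move: e'; rewrite hE (_ : logn 2 2 = 1) //; lia.
  exact: dvdn_mulr.
by rewrite dvdn1 => /eqP D_eq1; rewrite D_eq1 in D1.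
Qed.

(** * Asymptotic comparison of products *)

Section Asymptotics.
Local Open Scope ring_scope.
Variable R : archiRealFieldType.

Lemma eventually_linear_prod n (s : R) (a a' : nat -> R) (e : {poly R}) :
  (size e <= n.+1)%N ->
  0 < s ^+ n * (\sum_(j < n.+1) a' j - \sum_(j < n.+1) a j) + e`_n ->
  exists K, forall k, (K <= k)%N ->
    \prod_(j < n.+1) (s * k%:R + a j) < \prod_(j < n.+1) (s * k%:R + a' j) + e.[k%:R].
Proof.
move=> se pos.
have [||K pK] := @eventually_horner_gt0 _ (linear_prod n.+1 s a' - linear_prod n.+1 s a + e) n.
- by rewrite (leq_trans (size_polyD _ _)) // geq_max se size_linear_prodB.
- by rewrite coefD coef_linear_prodB.
exists K => k /pK; rewrite !hornerD hornerN !horner_linear_prod.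
by rewrite addrAC subr_gt0.
Qed.

Lemma sum_affine D (c w : R) :
  \sum_(j < D.+1) (c + w * j%:R) = D.+1%:R * (c + w * D%:R / 2).
Proof.
elim: D => [|D IH]; first by rewrite big_ord1 !mulr0 mul0r mul1r.
by rewrite big_ord_recr /= IH -[D.+2%:R]natr1 -[D.+1%:R]natr1; field.
Qed.

Lemma multichooseR m x : (m`! * multichoose m x)%:R = rising m x%:R :> R.
Proof. by rewrite fact_multichoose natr_prod; apply: eq_bigr => j _; rewrite natrD. Qed.

End Asymptotics.

Lemma exists_root (R : rcfType) (n : nat) (x : R) : (0 < x)%R ->
  exists2 y : R, (0 < y)%R & (y ^+ n.+1 = x)%R.
Proof.
move=> x0; have [||y /andP[y0 _]] := @numfield.Num.Theory.poly_ivt R ('X ^+ n.+1 - x%:P)%R 0%R (1 + x)%R.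
- by rewrite addr_ge0 // ltW.
- rewrite !hornerE expr0n /= sub0r oppr_le0 ltW //= subr_ge0.
  apply: (@le_trans _ _ (1 + x)%R); first by rewrite lerDr.
  by rewrite ler_eXnr // lerDl ltW.
rewrite rootE !hornerE subr_eq0 => /eqP yx; exists y => //.
by rewrite lt_def y0 andbT; apply: contraTneq x0 => y_eq0; rewrite -yx y_eq0 expr0n ltxx.
Qed.

(** * Pumping the image of a word in the first two letters *)

Section NotPreserved.
Variables (R : archiRcfType) (d lambda h i : nat).
Let D := d.+2.
Let l := D.+1.
Let b := lambda ^ D.
Hypotheses (lambda1 : 1 < lambda) (h34 : h = 3 \/ h = 4) (iE : 2 * i = h + (b - 1) * D).


Let b4 : 3 < b.
Proof. by rewrite (@leq_trans (2 ^ D)) ?leq_exp2r // (@leq_pexp2l 2 2). Qed.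

Let iER : (2 * i%:R = h%:R + (b%:R - 1) * D%:R :> R)%R.
Proof. by rewrite -natrM iE natrD natrM natrB // (ltn_trans _ b4). Qed.

Let h4 : (h%:R < 2 * b%:R :> R)%R.
Proof. by rewrite -natrM ltr_nat; case: h34 => ->; lia. Qed.

Let h0 : (0 < h%:R :> R)%R.
Proof. by rewrite ltr0n; case: h34 => ->. Qed.

Let bR0 : (0 < b%:R :> R)%R. Proof. by rewrite ltr0n (ltn_trans _ b4). Qed.

(** The mean offsets differ by [h / 2]. Up to a positive factor this is the coefficient of degree
    [D] in [multichoose l (b * n + i) - b ^ l * multichoose l n], where degree [l] cancels. *)
Let sum_shifted (c : nat) : (\sum_(j < D.+1) ((c + i)%:R + 1 * j%:R) - \sum_(j < D.+1) (c%:R + b%:R * j%:R)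
   = l%:R * h%:R / 2 :> R)%R.
Proof.
rewrite !sum_affine -/l natrD mul1r -mulrBr -[RHS]mulrA; congr (_ * _)%R.
by move: iER; lra.
Qed.

Let prod_shifted n :
  (\prod_(j < D.+1) (b%:R * n%:R + (i%:R + 1 * j%:R)) = (l`! * multichoose l (b * n + i))%:R :> R)%R.
Proof.
rewrite multichooseR natrD natrM; apply: eq_bigr => j _.
by rewrite mul1r addrA.
Qed.

Let prod_scaled n :
  (\prod_(j < D.+1) (b%:R * n%:R + b%:R * j%:R) = (l`! * (b ^ l * multichoose l n))%:R :> R)%R.
Proof.
rewrite mulnCA natrM multichooseR natrX -[X in (_ ^+ X)%R](card_ord D.+1) -prodr_const -big_split.
by apply: eq_bigr => j _; rewrite -mulrDr.
Qed.

Let l0 : (0 < l%:R :> R)%R. Proof. by rewrite ltr0n. Qed.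

(** The gap [h / 2] is positive. Together with [eventually_lt_scaledS] this pins down the length of
    a preimage. *)
Lemma eventually_scaled_lt : exists K, forall n, K <= n ->
  b ^ l * multichoose l n < multichoose l (b * n + i).
Proof.
have [||K hK] := @eventually_linear_prod R D b%:R (fun j => 0%:R + b%:R * j%:R)%R
  (fun j => (0 + i)%:R + 1 * j%:R)%R 0%R.
- by rewrite size_poly0.
- by rewrite sum_shifted coef0 addr0 mulr_gt0 ?exprn_gt0 // divr_gt0 // mulr_gt0.
exists K => n /hK; rewrite horner0 addr0 prod_shifted.
under eq_bigr do rewrite add0r; rewrite prod_scaled ltr_nat.
by rewrite ltn_pmul2l // fact_gt0.
Qed.

(** Passing from [n] to [n.+1] moves each offset by [b > h / 2], and [r] affects only the constant
    term. *)
Lemma eventually_lt_scaledS r : exists K, forall n, K <= n ->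
  multichoose l (b * n + i) + r < b ^ l * multichoose l n.+1.
Proof.
have [||K hK] := @eventually_linear_prod R D b%:R (fun j => (0 + i)%:R + 1 * j%:R)%R
  (fun j => b%:R + b%:R * j%:R)%R (- (l`! * r)%:R%:P)%R.
- by rewrite size_polyN (leq_trans (size_polyC_leq1 _)).
- rewrite coefN coefC /= oppr0 addr0 mulr_gt0 ?exprn_gt0 // !sum_affine -/l -mulrBr mulr_gt0 //.
  by move: iER h4; rewrite add0n; lra.
exists K => n /hK; rewrite hornerN hornerC ltrBrDr prod_shifted.
rewrite (_ : \prod_(j < D.+1) _ = (l`! * (b ^ l * multichoose l n.+1))%:R)%R; last first.
  rewrite -prod_scaled; apply: eq_bigr => j _; rewrite -natr1; ring.
by rewrite -natrD ltr_nat -mulnDr ltn_pmul2l // fact_gt0.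
Qed.

(** The sum on the right is the value of [a_2^n]; its second term adds [b > h / 2] to the mean
    offset. *)
Lemma eventually_lt_scaledD : exists K, forall n, K <= n ->
  multichoose l (b * n + i) < b ^ l * (multichoose l n + multichoose D n).
Proof.
have [||K hK] := @eventually_linear_prod R D b%:R (fun j => (0 + i)%:R + 1 * j%:R)%R
  (fun j => 0%:R + b%:R * j%:R)%R
  ((l * b ^ l)%:R *: linear_prod D 1 (fun j => 0 + j%:R))%R.
- by rewrite (leq_trans (size_scale_leq _ _)) // size_linear_prod.
- have bl : (b%:R ^+ l = b%:R ^+ D * b%:R :> R)%R by rewrite -exprSr.
  rewrite coefZ coef_linear_prod expr1n mulr1 -opprB sum_shifted natrM natrX bl.
  rewrite (_ : _ + _ = b%:R ^+ D * l%:R * (b%:R - h%:R / 2))%R; last first.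
    by move: (b%:R ^+ D)%R => x; field.
  apply: mulr_gt0; last by move: h4; lra.
  by apply: mulr_gt0 => //; apply: exprn_gt0.
exists K => n /hK; rewrite hornerZ -rising_linear mul1r addr0 prod_shifted.
under [X in (_ < X + _)%R]eq_bigr do rewrite add0r.
rewrite prod_scaled -multichooseR -natrM -natrD ltr_nat.
have -> : l * b ^ l * (D`! * multichoose D n) = l`! * (b ^ l * multichoose D n).
  by rewrite [l`!]factS; lia.
by rewrite -!mulnDr ltn_pmul2l // fact_gt0.
Qed.


(** Times [l!], the equation expresses [A * rising D] at [z k] as a polynomial [G] of degree [D] in
    [k]. Its leading coefficient determines [rho], which would be an integer, against
    [no_power_ratio]. *)
Lemma scaled_sequence_absurd n T r (z : nat -> nat) K : 0 < T ->
  (forall k, K <= k -> b ^ l * (multichoose l (n + k * T) + multichoose D (z k)) =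
    multichoose l (b * (n + k * T) + i) + r) -> False.
Proof.
move=> T0 eqz; pose s : R := (b%:R * T%:R)%R; pose A : R := (l * b ^ l)%:R%R.
pose G : {poly R} := (linear_prod D.+1 s (fun j => (b * n + i)%:R + 1 * j%:R) -
  linear_prod D.+1 s (fun j => (b * n)%:R + b%:R * j%:R) + (l`! * r)%:R%:P)%R.
have TR0 : (0 < T%:R :> R)%R by rewrite ltr0n.
have bl : (b%:R ^+ l = b%:R ^+ D * b%:R :> R)%R by rewrite -exprSr.
have bD0 : (0 < b%:R ^+ D :> R)%R by apply: exprn_gt0.
have TD0 : (0 < T%:R ^+ D :> R)%R by apply: exprn_gt0.
have A0 : (0 < A)%R by rewrite ltr0n muln_gt0 expn_gt0 (ltn_trans _ b4).
have x0 : (0 < h%:R * T%:R ^+ D / (2 * b%:R) :> R)%R.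
  by apply: divr_gt0; apply: mulr_gt0.
have [rho rho0 rhoD] := @exists_root R d.+1 _ x0.
have sG : (size G <= D.+1)%N.
  rewrite (leq_trans (size_polyD _ _)) // geq_max (leq_trans (size_polyC_leq1 _)) // andbT.
  by rewrite (leq_trans (size_linear_prodB _ _ _ _)).
have cG : (G`_D = A * rho ^+ D)%R.
  rewrite /G coefD coefC addr0 coef_linear_prodB (sum_shifted (b * n)).
  rewrite rhoD /A natrM natrX bl /s exprMn.
  have ident (x y u v w : R) : v != 0%R -> (x * y * (u * w / 2) = u * (x * v) * (w * y / (2 * v)))%R.
    by move=> v0; field.
  by apply: ident; rewrite lt0r_neq0.
have GE k : (K <= k)%N -> (A * rising D (z k)%:R = G.[k%:R])%R.
  move=> Kk; have e := congr1 (fun m => (l`! * m)%:R%R : R) (eqz k Kk).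
  rewrite hornerD hornerC hornerD hornerN !horner_linear_prod.
  rewrite (_ : \prod_(j < D.+1) (s * _ + (_ + 1 * _)) =
    (l`! * multichoose l (b * (n + k * T) + i))%:R)%R; last first.
    rewrite -prod_shifted; apply: eq_bigr => j _.
    by rewrite /s !(natrD, natrM); ring.
  rewrite (_ : \prod_(j < D.+1) (s * _ + (_ + b%:R * _)) =
    (l`! * (b ^ l * multichoose l (n + k * T)))%:R)%R; last first.
    rewrite -prod_scaled; apply: eq_bigr => j _.
    by rewrite /s !(natrD, natrM); ring.
  rewrite addrAC; apply/eqP; rewrite eq_sym subr_eq -natrD -mulnDr -e -multichooseR -natrM -natrD.
  apply/eqP; congr (_%:R)%R.
  have lf : l`! = l * D`! by exact: factS.
  by rewrite mulnDr mulnDr addnC; congr (_ + _); rewrite lf mulnACA.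
have [delta rhoE] := rising_sequence_slope A0 rho0 sG cG GE.
apply: (@no_power_ratio lambda delta h T D) => //; first exact: ltnW.
have e : (2 * b%:R * rho ^+ D = h%:R * T%:R ^+ D)%R.
  by rewrite rhoD mulrC divfK // lt0r_neq0 // mulr_gt0.
apply/eqP; rewrite -(eqr_nat R) -/b natrM [X in (X * _)%R]natrM [eqbRHS]natrM.
by rewrite (natrX _ delta) (natrX _ T) -rhoE e.
Qed.

Lemma rec_set_scale_not : ~ (forall Z : set ('I_l -> nat), rec_set Z ->
  rec_set [set c : 'I_l -> nat | exists2 c', Z c' & value c = b ^ l * value c']).
Proof.
move=> pres; pose Z : set ('I_l -> nat) := [set c | forall j : 'I_l, 2 <= j -> c j = 0].
have Z_value (c : 'I_l -> nat) : Z c -> value c = multichoose l (tail c 0) + multichoose D (tail c 1).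
  move=> Zc; rewrite value_recl2 big1 ?addn0 // => k _.
  rewrite /tail big1 ?multichoose0 ?subn_gt0 // => j kj.
  by apply: Zc; apply: leq_trans kj.
pose W : set ('I_l -> nat) := [set c | exists2 c', Z c' & value c = b ^ l * value c'].
have [N [T [T0 per]]] : rec_set W.
  apply: pres; exists 1, 1; split=> // c a ca; split=> Zc j j2; have := Zc j j2.
    by rewrite /raise => e; case: eqP ca => [<-|_]; rewrite e.
  by rewrite /raise; lia.
have [K1 hK1] := eventually_scaled_lt.
have [K2 hK2] := eventually_lt_scaledD.
(* The summand [N] serves the pumping threshold, and [D * b ^ l] makes [b ^ l * multichoose d.+1 n]
   at most [multichoose D n]. *)
pose n := K1 + K2 + N + D * b ^ l.
pose target := multichoose l (b * n + i).
(* [x2] is the least number of letters [a_2] for which the scaled value at length [n] reaches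
   [target], the smallest value at length [b * n + i]. *)
have [x2 x2_target x2_min] : {x2 | target <= b ^ l * (multichoose l n + multichoose D x2) &
    forall x, target <= b ^ l * (multichoose l n + multichoose D x) -> x2 <= x}.
  have ex : exists x, target <= b ^ l * (multichoose l n + multichoose D x).
    by exists n; apply: ltnW; apply: hK2; rewrite /n; lia.
  by case: (ex_minnP ex) => x; exists x.
have x2n : x2 <= n by apply: x2_min; apply: ltnW; apply: hK2; rewrite /n; lia.
have [r rE] : exists r, b ^ l * (multichoose l n + multichoose D x2) = target + r.
  by exists (b ^ l * (multichoose l n + multichoose D x2) - target); rewrite subnKC.
(* By minimality [r] is below one increment in [x2]. It is thus so small that the image has length
   [b * n + i] and at least [N] letters [a_1]. *)
have r_lt : r < multichoose D (b * n + i - N).+1.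
  case: x2 x2_target x2_min x2n rE => [|x] _ x2_min x2n.
    rewrite multichoose0 // addn0.
    have K1n : K1 <= n by rewrite /n; lia.
    by have := hK1 n K1n; rewrite -/target => lt_target e; lia.
  rewrite multichooseS => rE.
  have : ~~ (target <= b ^ l * (multichoose l n + multichoose D x)).
    by apply/negP => /x2_min; rewrite ltnn.
  rewrite -ltnNge => lt_target.
  have r_lt : r < b ^ l * multichoose d.+1 x.+1.
    by rewrite -(ltn_add2l target) -rE addnA mulnDr ltn_add2r.
  apply: leq_trans r_lt _.
  apply: (@leq_trans (b ^ l * multichoose d.+1 n)).
    by rewrite leq_mul2l leq_multichoose ?orbT.
  apply: (@leq_trans (multichoose D n)).
    rewrite -(@leq_pmul2l D) // mul_multichoose mulnA leq_mul2r.
    by apply/orP; right; rewrite /n; lia.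
  apply: leq_multichoose; have : 2 * n <= b * n by rewrite leq_mul2r (ltnW (ltnW b4)) orbT.
  by rewrite /n; lia.
have [Y YE] := @value_surj l (target + r) isT.
have Y_tail0 : tail Y 0 = b * n + i.
  have := value_bounds Y; rewrite YE => /andP[lo hi].
  apply/eqP; rewrite eqn_leq; apply/andP; split; rewrite -ltnS; apply: (@ltn_multichoose l).
    apply: leq_ltn_trans lo _; rewrite multichooseS ltn_add2l (leq_trans r_lt) //.
    by apply: leq_multichoose; rewrite ltnS leq_subr.
  by apply: leq_ltn_trans hi; rewrite leq_addr.
have value_raise t : value (raise Y ord0 t) = multichoose l (b * n + i + t) + r.
  move: YE; rewrite !value_recl2 !tail_raise Y_tail0 mul1n mul0n addn0.
  rewrite -/target -!addnA => /addnI <-; congr (_ + (_ + _)).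
  by apply: eq_bigr => k _; rewrite tail_raise mul0n addn0.
have Y0N : N <= Y ord0.
  have : tail Y 1 < (b * n + i - N).+1.
    apply: (@ltn_multichoose D); apply: leq_ltn_trans r_lt.
    move: YE; rewrite value_recl2 Y_tail0 -/target -addnA => /addnI <-.
    exact: leq_addr.
  have bn : N <= b * n by rewrite (@leq_trans n) ?leq_pmull ?(ltn_trans _ b4) // /n; lia.
  move: Y_tail0 bn; rewrite tail_recl; move: (b * n) (Y ord0) (tail Y 1); clear; lia.
have WY : W Y.
  pose x j := if j is j'.+1 then if j' is _.+1 then 0 else x2 else n.
  have xdec j : x j.+1 <= x j by case: j => [|[|]].
  have tailx j : j <= l -> tail (fun j : 'I_l => x j - x j.+1) j = x j.
    exact: tail_diff.
  have Zx : Z (fun j => x j - x j.+1) by move=> [[|[|j]]].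
  by exists (fun j => x j - x j.+1); rewrite // YE Z_value // !tailx // -rE.
(* The factor [b] turns the length of the image into [b * (n + k * T) + i], which fits a preimage of
   length [n + k * T]. *)
have WYk k : W (raise Y ord0 (k * b * T)) by exact: (rec_set_multiple (k * b) per Y0N).1.
have [K3 hK3] := eventually_lt_scaledS r.
have step k : exists z, K1 + K3 <= k ->
    b ^ l * (multichoose l (n + k * T) + multichoose D z) = multichoose l (b * (n + k * T) + i) + r.
  have [c Zc] := WYk k; rewrite value_raise => cE.
  exists (tail c 1) => Kk; set m := n + k * T.
  have km : k <= m by rewrite (leq_trans (leq_pmulr k T0)) // leq_addl.
  have mE : b * n + i + k * b * T = b * m + i by rewrite /m; lia.
  rewrite mE in cE; have /andP[lo hi] := value_bounds c.
  suff tm : tail c 0 = m by move: cE; rewrite (Z_value _ Zc) tm => <-.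
  have le1 : tail c 0 <= m.
    rewrite leqNgt; apply/negP => /(leq_multichoose l) lt_m.
    have := hK3 m ltac:(lia); rewrite cE ltnNge leq_mul2l.
    by rewrite (leq_trans lt_m lo) orbT.
  have le2 : m <= tail c 0.
    rewrite leqNgt; apply/negP => /(leq_multichoose l) lt_m.
    have := hK1 m ltac:(lia); apply/negP; rewrite -leqNgt.
    apply: (@leq_trans (b ^ l * value c)); first by rewrite -cE leq_addr.
    by rewrite leq_mul2l (leq_trans (ltnW hi) lt_m) orbT.
  by apply/eqP; rewrite eqn_leq le1.
have [z zE] := choice step.
exact: scaled_sequence_absurd T0 zE.
Qed.

End NotPreserved.

Lemma mul_not_preserves3 d lambda : 1 < lambda ->
  ~ mul_preserves_recognizable (bounded_lang d.+3) lambda.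
Proof.
move=> lambda1 /(@mul_preserves_exp _ _ (d.+2 * d.+3) isT) /mul_preservesP => /(_ isT).
rewrite expnM => pres.
have [h [h34 [i iE]]] : exists h, (h = 3 \/ h = 4) /\
    exists i, 2 * i = h + (lambda ^ d.+2 - 1) * d.+2.
  (* The parity of [m] selects [h], so that [h + m] is even. *)
  pose m := (lambda ^ d.+2 - 1) * d.+2; have := odd_double_half m.
  case: (odd m) => e; [exists 3 | exists 4]; (split; first by auto).
    by exists (m./2 + 2); rewrite -/m; lia.
  by exists (m./2 + 2); rewrite -/m; lia.
(* The real closure of the rationals is archimedean and contains the root [rho]. *)
exact: (@rec_set_scale_not {realclosure rat} d lambda h i).
Qed.

Theorem theorem32 (l lambda : nat) (hl : 1 <= l) (hlambda : 2 <= lambda) :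
  mul_preserves_recognizable (bounded_lang l) lambda <->
  l = 1 \/ (l = 2 /\ exists k : nat, odd k /\ lambda = k ^ 2).
Proof.
split=> [|[->|[-> [b [odd_b ->]]]]].
- case: l hl => [|[|[|d]]] // _; first by left.
    by move=> /(mul_preserves2_odd_square (ltnW hlambda)); right.
  by move=> /(mul_not_preserves3 hlambda).
- by apply/mul_preservesP => // Z; apply: rec_set_scale1; apply: ltnW.
apply/mul_preservesP => // Z; apply: (@rec_set_scale2 b b./2).
by rewrite -[LHS]odd_double_half odd_b mul2n addnC.
Qed.
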